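(* Let $\ell\le m$ be positive integers and let $X=x_{\ell+1}x_{\ell+2}\cdots x_m$ be any permutation of the set $\{\ell+1,\ell+2,\dots,m\}$. Then the permutation pattern $1\,2\,3\cdots(\ell-1)\,\ell\,X$ (i.e. the permutation $1,2,\dots,\ell,x_{\ell+1},\dots,x_m$ of $[m]$) is strongly $\star$-Wilf-equivalent to the pattern $\ell\,(\ell-1)\cdots 2\,1\,X$.
   Context: A hole is a special symbol $\diamond$. For $0\le k\le n$, $S_n^k$ denotes the set of partial permutations of length $n$ with $k$ holes: sequences $\pi=\pi_1\cdots\pi_n$ in which each number of $[n-k]=\{1,\dots,n-k\}$ appears exactly once and the remaining $k$ entries are $\diamond$. For $H\subseteq[n]$ with $|H|=k$, $S_n^H$ is the set of $\pi\in S_n^k$ with $\pi_i=\diamond$ exactly for $i\in H$. The standardization of a sequence of distinct integers replaces its $i$-th smallest entry by $i$. If $i(1)<\dots<i(n-k)$ are the positions of the non-holes of $\pi\in S_n^k$, a permutation $\sigma$ of $[n]$ is an extension of $\pi$ if the standardization of $\sigma_{i(1)}\cdots\sigma_{i(n-k)}$ equals $\pi_{i(1)}\cdots\pi_{i(n-k)}$. A permutation contains a pattern $p$ of length $\ell$ if it has a subsequence of length $\ell$ whose standardization is $p$. A partial permutation $\pi$ avoids $p$ if every extension of $\pi$ avoids $p$. $s_n^H(p)$ is the number of $p$-avoiding elements of $S_n^H$. Two patterns $p,q$ are strongly $\star$-Wilf-equivalent if $s_n^H(p)=s_n^H(q)$ for all $n\ge 0$ and all $H\subseteq[n]$. *)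

(* Defs.v *)
From mathcomp Require Import all_boot.

Set Implicit Arguments.
Unset Strict Implicit.
Unset Printing Implicit Defensive.

(* Permutations and patterns are written in one-line notation as sequences of
   naturals with values starting at 1: [s] is a permutation of {1, ..., n} iff
   [perm_eq s (iota 1 n)].  Positions (elements of ['I_n]) start at 0. *)

(* Only meaningful on sequences without repetitions. *)
Definition standardization (s : seq nat) : seq nat :=
  [seq (index x (sort leq s)).+1 | x <- s].

Definition contains (s p : seq nat) : bool :=
  [exists b : (size s).-tuple bool, standardization (mask b s) == p].

(* The hole is [None]; the values of a partial permutation lie in
   {1, ..., n}, hence the entries in [option 'I_n.+1] (the value 0 never occurs
   in an element of [partial_perms]). *)
Definition word (n : nat) := n.-tuple (option 'I_n.+1).

Definition nonholes (n : nat) (w : word n) : seq nat :=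
  [seq val v | v <- pmap id w].

Definition hole_set (n : nat) (w : word n) : {set 'I_n} :=
  [set i | tnth w i == None].

Definition partial_perms (n k : nat) : {set word n} :=
  [set w : word n | (count_mem None w == k)
                    && perm_eq (nonholes w) (iota 1 (n - k))].

Definition partial_perms_holes (n : nat) (H : {set 'I_n}) : {set word n} :=
  [set w in partial_perms n #|H| | hole_set w == H].

Definition extension (n : nat) (w : word n) (s : seq nat) : bool :=
  perm_eq s (iota 1 n)
  && (standardization (mask [seq isSome x | x <- w] s) == nonholes w).

Definition avoids (n : nat) (w : word n) (p : seq nat) : bool :=
  all (fun s => extension w s ==> ~~ contains s p) (permutations (iota 1 n)).

Definition avoid_count (n : nat) (H : {set 'I_n}) (p : seq nat) : nat :=
  #|[set w in partial_perms_holes H | avoids w p]|.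

Definition strongly_star_Wilf_equivalent (p q : seq nat) : Prop :=
  forall (n : nat) (H : {set 'I_n}), avoid_count H p = avoid_count H q.

(* Main.v *)
(* Write p = 1 2 ... l X and q = l ... 2 1 X.  A partial permutation contains a
   pattern iff some of its columns, read with the holes ignored, are ordered as
   the corresponding entries of the pattern.  Let D be the set of lattice points
   (c, v) such that X occurs in the columns to the right of c using only values
   above v; D is closed under going left and down.  Then p is contained iff, for
   some (c, v) in D, the number of holes among the first c columns plus the
   length of a longest increasing chain in the rectangle to the south-west of
   (c, v) is at least l; for q, "increasing" becomes "decreasing".

   So it suffices to change the entries in the cells of D, keeping the set of
   nonempty rows and columns, so that the longest increasing and decreasing
   chains are exchanged at every boundary point of D.  Fomin's growth diagrams do
   this: label each lattice point by the Robinson-Schensted shape of the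
   rectangle to its south-west, whose first row and first column measure the
   chains (Schensted, here proved with Viennot's shadow lines); conjugate the
   shapes on the boundary of D and run the invertible local rules backwards.
   This does not change D, since every occurrence of X that matters can be moved
   outside D. *)

Require Import Defs.
From mathcomp Require Import all_boot zify.

Set Implicit Arguments.
Unset Strict Implicit.
Unset Printing Implicit Defensive.

(** * Chains in 0/1 fillings *)

Definition filling := nat -> nat -> nat.

(** The entry is added to the larger neighbour, not to [lis A i' j']. In a partial permutation this
    still counts chains, since a point leaves the rest of its row and column empty ([lis_point]);
    the recursion is then Fomin's local rule for the first row. *)
Fixpoint lis (A : filling) (i : nat) : nat -> nat :=
  if i is i'.+1 then
    fix row j := if j is j'.+1 then maxn (lis A i' j) (row j') + A i' j' else 0
  else fun=> 0.

Arguments lis : simpl never.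

(* Viennot's skeleton: the points bumped out of the first row by
   Robinson-Schensted insertion. *)
Definition peel (A : filling) : filling := fun i j =>
  minn (lis A i j.+1) (lis A i.+1 j) - lis A i j.

(* [lam A i j] is the shape of the rectangle [0, i) x [0, j), as the function
   giving its row lengths. *)
Definition lam (A : filling) (i j r : nat) : nat := lis (iter r peel A) i j.

Definition trf (A : filling) : filling := fun i j => A j i.

Definition partial_perm_filling (A : filling) :=
  (forall i n, \sum_(j < n) A i j <= 1) /\ (forall j n, \sum_(i < n) A i j <= 1).

Lemma lis0r A i : lis A i 0 = 0. Proof. by case: i. Qed.

Lemma lisSS A i j :
  lis A i.+1 j.+1 = maxn (lis A i j.+1) (lis A i.+1 j) + A i j.
Proof. by []. Qed.

Lemma lis_trf A i j : lis (trf A) i j = lis A j i.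
Proof.
elim: i j => [|i IHi] j; first by rewrite lis0r.
by elim: j => [//|j IHj]; rewrite !lisSS IHi IHj maxnC.
Qed.

Lemma peel_trf A i j : peel (trf A) i j = peel A j i.
Proof. by rewrite /peel !(lis_trf A) minnC. Qed.

Lemma eq_lis A B i j :
  (forall a b, a < i -> b < j -> A a b = B a b) -> lis A i j = lis B i j.
Proof.
elim: i j => [//|i IHi]; elim=> [//|j IHj] eqAB.
rewrite !lisSS IHi ?IHj ?eqAB // => a b ai bj; apply: eqAB; lia.
Qed.

Lemma lis_leS A i j : lis A i j <= lis A i.+1 j.
Proof. by case: j => [|j]; rewrite ?lis0r // lisSS; lia. Qed.

Lemma lis_leSr A i j : lis A i j <= lis A i j.+1.
Proof. by case: i => [//|i]; rewrite lisSS; lia. Qed.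

Lemma lis_mono A i j i' j' : i <= i' -> j <= j' -> lis A i j <= lis A i' j'.
Proof.
move=> /subnK <- /subnK <-; apply: (@leq_trans (lis A i (j' - j + j))).
  elim: (j' - j) => [//|d IH]; exact: leq_trans IH (lis_leSr _ _ _).
elim: (i' - i) => [//|d IH]; exact: leq_trans IH (lis_leS _ _ _).
Qed.

(** In each cell the maximum in [lisSS] and the minimum in [peel] add up to the two neighbours, so
    the sum telescopes. In terms of insertion, the point of a column either lengthens the first row
    or is bumped into the skeleton. *)
Lemma lis_peel_col A i n :
  lis A i.+1 n + \sum_(j < n) peel A i j = lis A i n + \sum_(j < n) A i j.
Proof.
elim: n => [|n IH]; first by rewrite !big_ord0 !lis0r.
rewrite !big_ord_recr /= lisSS /peel.
have := lis_leS A i n; have := lis_leSr A i n.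
set s := \sum_(_ < n) _ in IH *; set t := \sum_(_ < n) _ in IH *; lia.
Qed.

Lemma lis_peel_row A j n :
  lis A n j.+1 + \sum_(i < n) peel A i j = lis A n j + \sum_(i < n) A i j.
Proof.
have := lis_peel_col (trf A) j n; rewrite !(lis_trf A) => <-.
by congr (_ + _); apply: eq_bigr => i _; rewrite peel_trf.
Qed.

Lemma partial_perm_filling_peel A :
  partial_perm_filling A -> partial_perm_filling (peel A).
Proof.
move=> [colA rowA]; split=> [i n|j n].
  by have := lis_peel_col A i n; have := lis_leS A i n; have := colA i n; lia.
by have := lis_peel_row A j n; have := lis_leSr A n j; have := rowA j n; lia.
Qed.

Lemma partial_perm_filling_trf A :
  partial_perm_filling A -> partial_perm_filling (trf A).
Proof. by case. Qed.

Lemma lis_step_point A i j :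
  lis A i j < lis A i.+1 j -> exists2 b, b < j & 0 < A i b.
Proof.
move=> lt_lis; have : 0 < \sum_(b < j) A i b.
  by have := lis_peel_col A i j; lia.
by rewrite lt0n sum_nat_eq0 negb_forall => /existsP[b]; rewrite -lt0n; exists b.
Qed.

Lemma lis_stepr_point A i j :
  lis A i j < lis A i j.+1 -> exists2 a, a < i & 0 < A a j.
Proof.
by have := @lis_step_point (trf A) j i; rewrite !(lis_trf A); apply.
Qed.

Section PartialPerm.
Variables (A : filling) (ppA : partial_perm_filling A).

Lemma filling_le1 i j : A i j <= 1.
Proof. by have := ppA.1 i j.+1; rewrite big_ord_recr /=; lia. Qed.

Lemma lis_step i j : lis A i.+1 j <= (lis A i j).+1.
Proof. by have := lis_peel_col A i j; have := ppA.1 i j; lia. Qed.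

Lemma lis_stepr i j : lis A i j.+1 <= (lis A i j).+1.
Proof. by have := lis_peel_row A j i; have := ppA.2 j i; lia. Qed.

Lemma filling_col_uniq i j j' : 0 < A i j -> 0 < A i j' -> j = j'.
Proof.
wlog lt_jj' : j j' / j < j'.
  by move=> H a b; case: (ltngtP j j') => // l; [|symmetry]; exact: H.
have := ppA.1 i j'.+1; rewrite big_ord_recr /= (bigD1 (Ordinal lt_jj')) //=.
lia.
Qed.

Lemma lis_point i j :
  0 < A i j -> lis A i j.+1 = lis A i j /\ lis A i.+1 j = lis A i j.
Proof.
have := lis_peel_col A i j; have := ppA.1 i j.+1.
have := lis_peel_row A j i; have := ppA.2 j i.+1.
rewrite !big_ord_recr /=.
by have := lis_leS A i j; have := lis_leSr A i j; lia.
Qed.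

End PartialPerm.

Lemma filling_row_uniq A i i' j :
  partial_perm_filling A -> 0 < A i j -> 0 < A i' j -> i = i'.
Proof.
move=> /partial_perm_filling_trf pp; exact: (@filling_col_uniq _ pp j).
Qed.

(** * Schensted's theorem for increasing and decreasing chains *)

Definition inc_rel (x y : nat * nat) := (x.1 < y.1) && (x.2 < y.2).
Definition dec_rel (x y : nat * nat) := (x.1 < y.1) && (y.2 < x.2).

Definition chain_in (R : rel (nat * nat)) (A : filling) (i j : nat)
    (s : seq (nat * nat)) :=
  all (fun z => [&& z.1 < i, z.2 < j & 0 < A z.1 z.2]) s && pairwise R s.

Definition has_chain (R : rel (nat * nat)) (A : filling) (i j k : nat) :=
  exists2 s, chain_in R A i j s & size s = k.

Lemma has_inc_chain A i j k :
  partial_perm_filling A -> has_chain inc_rel A i j k <-> k <= lis A i j.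
Proof.
move=> ppA; split=> [[s + <-]|].
  (* The last point has all others strictly to its south-west, so induction applies to the rectangle
     that it cuts off. *)
  elim/last_ind: s i j => [//|s [a b] IH] i j.
  rewrite /chain_in all_rcons pairwise_rcons size_rcons /=.
  move=> /andP[/andP[/and3P[ai bj Aab] sA] /andP[ltab prs]].
  have : size s <= lis A a b.
    apply: IH; rewrite /chain_in prs andbT; apply/allP=> z zs.
    by have /andP[-> ->] := allP ltab z zs; have /and3P[] := allP sA z zs.
  have : lis A a.+1 b.+1 <= lis A i j by exact: lis_mono.
  by have [] := lis_point ppA Aab; rewrite lisSS; lia.
have [s sP <-] : has_chain inc_rel A i j (lis A i j).
  elim: i j => [|i IHi]; first by move=> j; exists [::].
  elim=> [|j IHj]; first by exists [::].
  have [A0|Apos] := posnP (A i j).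
    rewrite lisSS A0 addn0 /maxn; case: ifP => _.
      have [s /andP[sA sR] <-] := IHj; exists s => //.
      by rewrite /chain_in sR andbT; apply: sub_all sA => z; lia.
    have [s /andP[sA sR] <-] := IHi j.+1; exists s => //.
    by rewrite /chain_in sR andbT; apply: sub_all sA => z; lia.
  have [e1 e2] := lis_point ppA Apos.
  have [s /andP[sA sR] sz] := IHi j; exists (rcons s (i, j)).
    rewrite /chain_in all_rcons pairwise_rcons sR /= Apos !ltnSn /= andbT.
    by apply/andP; split; apply: sub_all sA => z; rewrite /inc_rel /=; lia.
  by rewrite size_rcons sz lisSS e1 e2; have := filling_le1 ppA i j; lia.
move=> le_k; exists (take k s); last by rewrite size_takel.
case/andP: sP => sA sR; rewrite /chain_in.
rewrite (subseq_pairwise (take_subseq _ _) sR) andbT.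
by apply/allP=> z /mem_take; exact: (allP sA).
Qed.

(** In an empty cell [lisSS] is a plain maximum, so a step from column [a] to [a.+1] at the top of
    the cell already occurs at its bottom; as steps have height at most one, [lis A a] does not
    change on the way down. *)
Lemma lis_step_down A a b b' :
  partial_perm_filling A -> b' <= b ->
  (forall j, b' <= j < b -> A a j = 0) -> lis A a b < lis A a.+1 b ->
  lis A a b' = lis A a b /\ lis A a b' < lis A a.+1 b'.
Proof.
move=> ppA /subnK <-; elim: (b - b') => [//|d IH] A0.
rewrite addSn => lt_lis; rewrite addSn in A0.
have [e lt] : lis A a (d + b') = lis A a (d + b').+1 /\
    lis A a (d + b') < lis A a.+1 (d + b').
  move: lt_lis; rewrite lisSS A0 ?leqnn ?leq_addl // addn0.
  have := lis_step ppA a (d + b'); have := lis_leSr A a (d + b'); lia.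
by rewrite -e; apply: IH => // j jP; apply: A0; lia.
Qed.

Lemma lis_stepr_down A b a a' :
  partial_perm_filling A -> a' <= a ->
  (forall i, a' <= i < a -> A i b = 0) -> lis A a b < lis A a b.+1 ->
  lis A a' b = lis A a b /\ lis A a' b < lis A a' b.+1.
Proof.
move=> /partial_perm_filling_trf pp le A0.
by have := lis_step_down pp le A0; rewrite !(lis_trf A).
Qed.

Lemma peel_gt0 A i j : 0 < peel A i j ->
  lis A i j < lis A i j.+1 /\ lis A i j < lis A i.+1 j.
Proof. rewrite /peel; lia. Qed.

(* Otherwise no point would separate the shadow lines through [x] and [y], so the
   step of [lis] at [x] would propagate down to the row of [y], where [lis] is
   constant. *)
Lemma point_between_peel A x y : partial_perm_filling A ->
  0 < peel A x.1 x.2 -> 0 < peel A y.1 y.2 -> dec_rel x y ->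
  exists p, [/\ 0 < A p.1 p.2, x.1 <= p.1 < y.1 & y.2 <= p.2 < x.2].
Proof.
move: x y => [a b] [a' b'] ppA /= /peel_gt0[/= r c] /peel_gt0[/= r' c'].
rewrite /dec_rel /= => /andP[lta ltb].
have [/existsP[i /existsP[j ijP]]|/existsPn noA] := boolP [exists i : 'I_a',
   exists j : 'I_b, [&& a <= i, b' <= j & 0 < A i j]].
  by exists (val i, val j); move: (ltn_ord i) (ltn_ord j) => /=; split; lia.
have A0 i j : a <= i < a' -> b' <= j < b -> A i j = 0.
  move=> /andP[ai ia'] /andP[bj jb].
  have /existsPn/(_ (Ordinal jb)) := noA (Ordinal ia').
  by rewrite /= ai bj /= -eqn0Ngt => /eqP.
have [e1 l1] := lis_step_down ppA (ltnW ltb) (fun j => A0 a j ltac:(lia)) c.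
have [e2 l2] : lis A a b' = lis A a' b' /\ lis A a b' < lis A a b'.+1.
  by apply: lis_stepr_down r' => //; [exact: ltnW | move=> i iP; apply: A0; lia].
by have := lis_mono A lta (leqnn b'); lia.
Qed.

(** Just right of [x], [lis] steps up across row [b]; just above [y], it steps up across column
    [a']. Such a step persists to the right, respectively upwards, until a skeleton point is met. If
    none is met earlier, both steps reach the cell [(a', b)], which is then a skeleton point. *)
Lemma peel_between_points A x y : partial_perm_filling A ->
  0 < A x.1 x.2 -> 0 < A y.1 y.2 -> dec_rel x y ->
  exists p, [/\ 0 < peel A p.1 p.2, x.1 < p.1 <= y.1 & y.2 < p.2 <= x.2].
Proof.
move: x y => [a b] [a' b'] ppA /= Aab Aab'.
rewrite /dec_rel /= => /andP[lta ltb].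
have [e1 e2] := lis_point ppA Aab; have [e1' e2'] := lis_point ppA Aab'.
have [r c] : lis A a.+1 b < lis A a.+1 b.+1 /\
             lis A a' b'.+1 < lis A a'.+1 b'.+1.
  by rewrite !lisSS; lia.
have [/existsP[i ipos]|/existsPn no_i] :=
  boolP [exists i : 'I_a'.+1, (a < i) && (0 < peel A i b)].
  by exists (val i, b); move: (ltn_ord i) => /=; split; lia.
have [/existsP[j jpos]|/existsPn no_j] :=
  boolP [exists j : 'I_b.+1, (b' < j) && (0 < peel A a' j)].
  by exists (a', val j); move: (ltn_ord j) => /=; split; lia.
have peel0r i : a < i -> i <= a' -> peel A i b = 0.
  move=> ai ia; have := no_i (Ordinal (ia : i < a'.+1)); rewrite /=; lia.
have peel0c j : b' < j -> j <= b -> peel A a' j = 0.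
  move=> bj jb; have := no_j (Ordinal (jb : j < b.+1)); rewrite /=; lia.
have rP d : a + d < a' -> lis A (a + d).+1 b < lis A (a + d).+1 b.+1.
  elim: d => [|d IH] ltd; first by rewrite addn0.
  have := IH ltac:(lia); have := peel0r (a + d).+1 ltac:(lia) ltac:(lia).
  rewrite addnS /peel [lis A (a + d).+2 b.+1]lisSS.
  have := lis_leS A (a + d).+1 b; lia.
have cP d : b' + d < b -> lis A a' (b' + d).+1 < lis A a'.+1 (b' + d).+1.
  elim: d => [|d IH] ltd; first by rewrite addn0.
  have := IH ltac:(lia); have := peel0c (b' + d).+1 ltac:(lia) ltac:(lia).
  rewrite addnS /peel [lis A a'.+1 (b' + d).+2]lisSS.
  have := lis_leSr A a' (b' + d).+1; lia.
have := rP (a' - a.+1) ltac:(lia); have := cP (b - b'.+1) ltac:(lia).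
have -> : (b' + (b - b'.+1)).+1 = b by lia.
have -> : (a + (a' - a.+1)).+1 = a' by lia.
by have := peel0r a' lta (leqnn _); rewrite /peel; lia.
Qed.

(** [point_between_peel] supplies a point between consecutive skeleton points, and the last skeleton
    point has a point below it in its column. The bounds relative to [x] allow a further point to be
    put in front. *)
Lemma dec_chain_of_peel A i j x s : partial_perm_filling A ->
  chain_in dec_rel (peel A) i j (x :: s) ->
  exists2 t, chain_in dec_rel A i j t &
    size t = (size s).+1 /\ all (fun z => (x.1 <= z.1) && (z.2 < x.2)) t.
Proof.
move=> ppA; elim: s x => [|y s IH] x.
  rewrite /chain_in /= !andbT => /and3P[xi xj /peel_gt0[_ /lis_step_point[b bx Ab]]].
  by exists [:: (x.1, b)]; rewrite /= ?xi ?Ab ?bx ?leqnn //=; lia.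
move=> /andP[/andP[/and3P[xi xj px] sA] /andP[/andP[xy xs] sR]].
have [|t tP [szt t_lt]] := IH y; first by rewrite /chain_in /= sA; exact: sR.
have py : 0 < peel A y.1 y.2 by case/andP: sA => /and3P[].
have yi : y.1 < i by case/andP: sA => /and3P[].
have [p [pA px1 px2]] := point_between_peel ppA px py xy.
case/andP: tP => tA tR; exists (p :: t).
  rewrite /chain_in /= tA tR pA !andbT; apply/andP; split; first by lia.
  by apply: sub_all t_lt => z; rewrite /dec_rel; lia.
rewrite /= szt; split=> //; apply/andP; split; first by lia.
by apply: sub_all t_lt => z; move: xy; rewrite /dec_rel; lia.
Qed.

Lemma peel_chain_of_dec A i j x s : partial_perm_filling A ->
  chain_in dec_rel A i j (x :: s) ->
  exists2 t, chain_in dec_rel (peel A) i j t &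
    size t = size s /\ all (fun z => (x.1 < z.1) && (z.2 <= x.2)) t.
Proof.
move=> ppA; elim: s x => [|y s IH] x; first by exists [::].
move=> /andP[/andP[/and3P[xi xj px] sA] /andP[/andP[xy xs] sR]].
have [|t tP [szt t_lt]] := IH y; first by rewrite /chain_in /= sA; exact: sR.
have py : 0 < A y.1 y.2 by case/andP: sA => /and3P[].
have yi : y.1 < i by case/andP: sA => /and3P[].
have [p [pA px1 px2]] := peel_between_points ppA px py xy.
case/andP: tP => tA tR; exists (p :: t).
  rewrite /chain_in /= tA tR pA !andbT; apply/andP; split; first by lia.
  by apply: sub_all t_lt => z; rewrite /dec_rel; lia.
rewrite /= szt; split=> //; apply/andP; split; first by lia.
by apply: sub_all t_lt => z; move: xy; rewrite /dec_rel; lia.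
Qed.

(** Points and skeleton points interlace along a decreasing chain. The surplus point lies in the row
    of the first skeleton point, to its left. *)
Lemma has_dec_chain_peel A i j k : partial_perm_filling A ->
  has_chain dec_rel A i j k.+2 <-> has_chain dec_rel (peel A) i j k.+1.
Proof.
move=> ppA; split=> [] [[//|x s] sP [szs]].
  by have [t tP [szt _]] := peel_chain_of_dec ppA sP; exists t; rewrite ?szt.
have [t /andP[tA tR] [szt t_lt]] := dec_chain_of_peel ppA sP.
case/andP: sP => /andP[/and3P[xi xj /peel_gt0[/lis_stepr_point[a ax Aa] _]] _] _.
exists ((a, x.2) :: t); last by rewrite /= szt szs.
rewrite /chain_in /= tA tR xj Aa !andbT; apply/andP; split; first by lia.
by apply: sub_all t_lt => z; rewrite /dec_rel /=; lia.
Qed.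

(** Each peeling shortens the decreasing chains by one and removes the first row of the shape, so
    the length of the first column measures the chains. *)
Lemma has_dec_chain A i j k : partial_perm_filling A ->
  has_chain dec_rel A i j k.+1 <-> 0 < lam A i j k.
Proof.
elim: k A => [|k IH] A ppA.
  rewrite /lam /= -has_inc_chain //.
  by split=> [] [[|x [|y s]] // sP _]; exists [:: x].
by rewrite has_dec_chain_peel // IH ?/lam -?iterSr //;
   exact: partial_perm_filling_peel.
Qed.

(** * Shapes and the local rule *)

Section Shapes.
Variable K : nat.
Implicit Types f g mu nu la : nat -> nat.

Definition shape f :=
  [/\ forall r, f r.+1 <= f r, forall r, K <= r -> f r = 0 & forall r, f r <= K].

Definition shape_size f := \sum_(r < K) f r.

Definition at_most_one_box f g :=
  (forall r, f r <= g r) /\ shape_size g <= (shape_size f).+1.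

Definition conj_shape f : nat -> nat := fun s => \sum_(r < K) (s < f r).

Lemma shape_mono f r r' : shape f -> r <= r' -> f r' <= f r.
Proof.
move=> [fS _ _] /subnK <-; elim: (r' - r) => [//|d IH].
exact: leq_trans (fS _) IH.
Qed.

(** As [f] decreases weakly, the rows longer than [s] form an initial segment, and [conj_shape]
    counts them; this is the reflection of the Young diagram. *)
Lemma lt_conj_shape f r s : shape f -> (r < conj_shape f s) = (s < f r).
Proof.
move=> fP; have [_ f0 _] := fP; rewrite /conj_shape; case: (ltnP s (f r)) => sr.
  have rK : r < K by rewrite ltnNge; apply/negP => /f0 e; rewrite e in sr.
  rewrite -(big_mkord xpredT (fun r => (s < f r) : nat)).
  rewrite (big_cat_nat _ (n := r.+1)) //= big_nat.
  rewrite (eq_bigr (fun=> 1)) => [|i ir].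
    by rewrite -big_nat sum_nat_const_nat; lia.
  by case/andP: ir => _ ir; rewrite (leq_trans sr (shape_mono fP _)).
apply/negbTE; rewrite -leqNgt.
apply: (@leq_trans (\sum_(i < K) (i < r))).
  apply: leq_sum => i _; case: (ltnP i r) => ir; first by case: (s < _).
  by have := shape_mono fP ir; lia.
elim: (K) => [|k IH]; first by rewrite big_ord0.
rewrite big_ord_recr /=; case: (ltnP k r) => kr; last by rewrite addn0.
apply: (@leq_trans (\sum_(i < k) 1 + 1)); last by rewrite sum1_card card_ord; lia.
by rewrite leq_add2r; apply: leq_sum => i _; exact: leq_b1.
Qed.

Lemma nat_eq_lt m n : (forall k, (k < m) = (k < n)) -> m = n.
Proof.
by move=> e; have := e m; have := e n; lia.
Qed.

Lemma shape_conj f : shape f -> shape (conj_shape f).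
Proof.
move=> fP; have [_ f0 fK] := fP; split=> [r|r Kr|r].
- rewrite leqNgt -(rwP negP) lt_conj_shape //.
  by move=> lt; have := ltn_trans (ltnSn r) lt; rewrite -lt_conj_shape // ltnn.
- by apply: nat_eq_lt => k; rewrite lt_conj_shape //; have := fK k; lia.
- by rewrite leqNgt -(rwP negP) lt_conj_shape // f0.
Qed.

Lemma conj_shapeK f r : shape f -> conj_shape (conj_shape f) r = f r.
Proof.
move=> fP; apply: nat_eq_lt => k.
by rewrite !lt_conj_shape //; exact: shape_conj.
Qed.

Lemma eq_conj_shape f g s : f =1 g -> conj_shape f s = conj_shape g s.
Proof. by move=> e; apply: eq_bigr => i _; rewrite e. Qed.

Lemma sum_ltn (n c : nat) : c <= n -> \sum_(s < n) (s < c) = c.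
Proof.
elim: n => [|n IH] cn; first by rewrite big_ord0; lia.
rewrite big_ord_recr /=; case: (ltnP n c) => nc.
  have -> : c = n.+1 by lia.
  rewrite (eq_bigr (fun=> 1)) => [|i _]; last by have := ltn_ord i; lia.
  by rewrite sum1_card card_ord addn1.
by rewrite IH // addn0.
Qed.

Lemma shape_size_conj f : shape f -> shape_size (conj_shape f) = shape_size f.
Proof.
move=> [_ _ fK]; rewrite /shape_size /conj_shape exchange_big /=.
by apply: eq_bigr => r _; rewrite sum_ltn.
Qed.

Lemma at_most_one_box_conj f g : shape f -> shape g ->
  at_most_one_box f g -> at_most_one_box (conj_shape f) (conj_shape g).
Proof.
move=> fP gP [le sz]; split; last by rewrite !shape_size_conj.
by move=> s; apply: leq_sum => r _; have := le r; lia.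
Qed.

(** Otherwise rows [r] and [r.+1] would both gain a box, since [f r.+1 <= f r < g r.+1 <= g r]. *)
Lemma at_most_one_box_interlace f g r : shape f -> shape g ->
  at_most_one_box f g -> g r.+1 <= f r.
Proof.
move=> [fS _ _] [gS g0 _] [le sz]; rewrite leqNgt; apply/negP => lt.
have rK : r.+1 < K by rewrite ltnNge; apply/negP => /g0 e; rewrite e in lt.
move: sz; rewrite /shape_size; apply/negP; rewrite -ltnNge.
have -> : \sum_(i < K) g i = \sum_(i < K) (g i - f i) + \sum_(i < K) f i.
  by rewrite -big_split; apply: eq_bigr => i _ /=; rewrite subnK.
have : 1 < \sum_(i < K) (g i - f i).
  rewrite (bigD1 (Ordinal rK)) //= (bigD1 (Ordinal (ltnW rK))) /=; last first.
    by rewrite -val_eqE /=; lia.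
  by have := gS r; have := fS r; lia.
by lia.
Qed.

(* The inverse Fomin local rule: the south-west label of a cell, given the
   other three. *)
Definition sw_shape mu nu la : nat -> nat :=
  fun r => maxn (mu r.+1) (nu r.+1) + minn (mu r) (nu r) - la r.+1.

Section LocalRule.
Variables (mu nu la : nat -> nat).
Hypotheses (muP : shape mu) (nuP : shape nu) (laP : shape la).
Hypotheses (mu_la : at_most_one_box mu la) (nu_la : at_most_one_box nu la).
Let rho := sw_shape mu nu la.

Let mu_int r := at_most_one_box_interlace r muP laP mu_la.
Let nu_int r := at_most_one_box_interlace r nuP laP nu_la.

Lemma sw_shape_le r : rho r <= mu r /\ rho r <= nu r.
Proof. by have := mu_la.1 r.+1; have := nu_la.1 r.+1; rewrite /rho /sw_shape; lia. Qed.

(** By interlacing, [la r.+1] is at most [mu r] and [nu r]; it is at least [mu r.+1] and [nu r.+1].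
    So neither this subtraction nor the one in [sw_shape] is truncated. *)
Lemma sw_shape_rule r :
  la r.+1 = maxn (mu r.+1) (nu r.+1) + (minn (mu r) (nu r) - rho r).
Proof.
have := mu_la.1 r.+1; have := nu_la.1 r.+1; have := mu_int r; have := nu_int r.
by rewrite /rho /sw_shape; lia.
Qed.

Lemma shape_sw : shape rho.
Proof.
have [muS mu0 muK] := muP; have [nuS nu0 nuK] := nuP; have [laS la0 laK] := laP.
split=> r.
- have := sw_shape_rule r.+1; have := sw_shape_le r.+1.
  have := mu_int r; have := nu_int r.
  by have := mu_la.1 r.+1; have := nu_la.1 r.+1; rewrite /rho /sw_shape; lia.
- by move=> Kr; have := sw_shape_le r; have := mu0 r Kr; lia.
- by have := sw_shape_le r; have := muK r; lia.
Qed.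

Lemma shape_sizeS f : shape f -> \sum_(r < K) f r.+1 + f 0 = shape_size f.
Proof.
move=> [_ f0 _]; rewrite /shape_size.
have <- : \sum_(r < K.+1) f r = \sum_(r < K) f r.
  by rewrite big_ord_recr /= f0 // addn0.
by rewrite big_ord_recl addnC.
Qed.

(** When [sw_shape_rule] is summed over the rows, maxima and minima combine to [mu] and [nu]. Only
    row 0 of [la], which the rule does not reach, is left over; its excess will be the entry of the
    cell. *)
Lemma shape_size_sw :
  shape_size rho + shape_size la =
  shape_size mu + shape_size nu + (la 0 - maxn (mu 0) (nu 0)).
Proof.
have sumE : \sum_(r < K) (rho r + la r.+1) =
    \sum_(r < K) (maxn (mu r.+1) (nu r.+1) + minn (mu r) (nu r)).
  by apply: eq_bigr => r _; have := sw_shape_rule r; have := sw_shape_le r; lia.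
have maxP : shape (fun r => maxn (mu r) (nu r)).
  have [muS mu0 muK] := muP; have [nuS nu0 nuK] := nuP; split=> r.
  - by have := muS r; have := nuS r; lia.
  - by move=> Kr; rewrite mu0 // nu0.
  - by have := muK r; have := nuK r; lia.
have e : shape_size (fun r => maxn (mu r) (nu r)) + \sum_(r < K) minn (mu r) (nu r) =
    shape_size mu + shape_size nu.
  by rewrite /shape_size -!big_split /=; apply: eq_bigr => r _; lia.
rewrite !big_split /= in sumE.
have := shape_sizeS laP; have := shape_sizeS maxP.
have := mu_la.1 0; have := nu_la.1 0; move: sumE e; rewrite /shape_size.
set s1 := \sum_(_ < K) _; set s2 := \sum_(_ < K) _; set s3 := \sum_(_ < K) _.
set s4 := \sum_(_ < K) _; set s5 := \sum_(_ < K) _; set s6 := \sum_(_ < K) _.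
set s7 := \sum_(_ < K) _; set s8 := \sum_(_ < K) _.
lia.
Qed.

Lemma at_most_one_box_sw : at_most_one_box rho mu /\ at_most_one_box rho nu.
Proof.
have le : shape_size rho <= shape_size mu /\ shape_size rho <= shape_size nu.
  by split; apply: leq_sum => r _; have := sw_shape_le r; lia.
have := shape_size_sw; have [_ mu_sz] := mu_la; have [_ nu_sz] := nu_la.
by move=> ?; split; (split=> [r|]; [have := sw_shape_le r|]); lia.
Qed.

End LocalRule.
End Shapes.

(** * Growth diagrams *)

Lemma partial_perm_filling_iter A r :
  partial_perm_filling A -> partial_perm_filling (iter r peel A).
Proof.
by move=> ppA; elim: r => //= r IH; exact: partial_perm_filling_peel.
Qed.

Lemma lam_0 A i j : lam A i.+1 j.+1 0 = maxn (lam A i j.+1 0) (lam A i.+1 j 0) + A i j.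
Proof. by []. Qed.

Lemma lam_S A i j r :
  lam A i.+1 j.+1 r.+1 =
  maxn (lam A i j.+1 r.+1) (lam A i.+1 j r.+1) +
  (minn (lam A i j.+1 r) (lam A i.+1 j r) - lam A i j r).
Proof. by []. Qed.

Lemma eq_peel A B : (forall i j, A i j = B i j) -> forall i j, peel A i j = peel B i j.
Proof. by move=> e i j; rewrite /peel !(@eq_lis A B). Qed.

Lemma lam_trf A i j r : lam (trf A) i j r = lam A j i r.
Proof.
rewrite /lam -(lis_trf (iter r peel A)); apply: eq_lis => a b _ _.
elim: r a b => //= r IH a b; rewrite -[RHS](peel_trf (iter r peel A)).
exact: eq_peel.
Qed.

Section Lam.
Variables (A : filling) (ppA : partial_perm_filling A).

(** Across a skeleton cell both sides grow by exactly one; elsewhere the left side only takes a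
    maximum. This makes the rows of [lam] weakly decreasing. *)
Lemma lis_peel_le i j : lis (peel A) i j <= lis A i j.
Proof.
have ppP := partial_perm_filling_peel ppA.
elim: i j => [//|i IHi]; elim=> [|j IHj]; first by rewrite lis0r.
have [P0|Ppos] := posnP (peel A i j).
  by rewrite !lisSS P0; have := IHi j.+1; lia.
have [-> ->] : lis (peel A) i.+1 j.+1 = (lis (peel A) i j).+1 /\
    lis A i.+1 j.+1 = (lis A i j).+1; last exact: IHi.
have [e1 e2] := lis_point ppP Ppos; have := filling_le1 ppP i j.
rewrite !lisSS e1 e2; have [lt1 lt2] := peel_gt0 Ppos; split; first by lia.
have [A0|Apos] := posnP (A i j); last by have := lis_point ppA Apos; lia.
by have := lis_step ppA i j; have := lis_stepr ppA i j; lia.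
Qed.

Lemma lis_size_le i j : lis A i j <= j.
Proof.
by elim: j => [|j IH]; [rewrite lis0r | have := lis_stepr ppA i j; lia].
Qed.

(** Summing [lis_peel_col] over the successive skeletons telescopes: the point of a column adds one
    box to the first [k] rows unless it is bumped through all of them. *)
Lemma lam_boxes_col i j k :
  \sum_(r < k) lam A i.+1 j r + \sum_(b < j) iter k peel A i b =
  \sum_(r < k) lam A i j r + \sum_(b < j) A i b.
Proof.
elim: k => [|k IH]; first by rewrite !big_ord0.
have := lis_peel_col (iter k peel A) i j.
rewrite !big_ord_recr /= -/(lam A i.+1 j k) -/(lam A i j k); move: IH.
set s1 := \sum_(_ < _) _; set s2 := \sum_(_ < _) _; set s3 := \sum_(_ < _) _.
set s4 := \sum_(_ < _) _; set s5 := \sum_(_ < _) _; lia.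
Qed.

Lemma at_most_one_box_lam K i j :
  at_most_one_box K (lam A i j) (lam A i.+1 j).
Proof.
split=> [r|]; first exact: lis_leS.
by have := lam_boxes_col i j K; have := ppA.1 i j; rewrite /shape_size; lia.
Qed.

End Lam.

(** Each peeling empties one more row from the bottom, so the [r]-th skeleton has no point in rows
    below [r]. *)
Lemma lam_out A i j r : j <= r -> lam A i j r = 0.
Proof.
have peel0 r' a b : b < r' -> iter r' peel A a b = 0.
  elim: r' a b => //= r' IH a b br.
  have lis_0 a' b' : b' <= r' -> lis (iter r' peel A) a' b' = 0.
    move=> br'; rewrite (@eq_lis _ (fun _ _ => 0)) => [|u v _ vb]; last first.
      by apply: IH; lia.
    elim: a' b' {br'} => [//|a' IHa]; elim=> [|b' IHb]; first by rewrite lis0r.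
    by rewrite lisSS IHa IHb.
  by rewrite /peel [lis _ a.+1 b]lis_0 //; lia.
move=> jr; rewrite /lam (@eq_lis _ (fun _ _ => 0)) => [|a b _ bj]; last first.
  by apply: peel0; lia.
elim: i j {jr} => [//|i IHi]; elim=> [|j IHj]; first by rewrite lis0r.
by rewrite lisSS IHi IHj.
Qed.

Section Region.
Variables (K : nat) (D : nat -> nat -> bool).
Hypothesis D_le : forall i j i' j', i <= i' -> j <= j' -> D i' j' -> D i j.
Hypothesis D_bound : forall i j, D i j -> i <= K /\ j <= K.

Definition valid_labels (G : nat -> nat -> nat -> nat) :=
  [/\ forall i j, D i j -> shape K (G i j),
      forall i j r, D i j -> i = 0 \/ j = 0 -> G i j r = 0,
      forall i j, D i.+1 j -> at_most_one_box K (G i j) (G i.+1 j)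
    & forall i j, D i j.+1 -> at_most_one_box K (G i j) (G i j.+1)].

Lemma valid_lam A : partial_perm_filling A -> valid_labels (lam A).
Proof.
move=> ppA; split=> [i j Dij|i j r _ [->|->]|i j _|i j _].
- have [iK jK] := D_bound Dij; split=> r.
  + by apply: lis_peel_le; exact: partial_perm_filling_iter.
  + by move=> Kr; apply: lam_out; lia.
  + apply: leq_trans jK; apply: lis_size_le.
    exact: partial_perm_filling_iter.
- by [].
- exact: lis0r.
- exact: at_most_one_box_lam.
- have := at_most_one_box_lam (partial_perm_filling_trf ppA) K j i.
  case=> le sz; split=> [r|]; first by have := le r; rewrite !(lam_trf A).
  move: sz; rewrite /shape_size.
  under eq_bigr do rewrite (lam_trf A).
  by under [X in _ <= X.+1 -> _]eq_bigr do rewrite (lam_trf A).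
Qed.

Lemma valid_conj G :
  valid_labels G -> valid_labels (fun i j => conj_shape K (G i j)).
Proof.
case=> shG G0 colG rowG; split=> [i j Dij|i j r Dij ij0|i j Dij|i j Dij].
- exact/shape_conj/shG.
- by rewrite /conj_shape big1 // => s _; rewrite G0.
- by apply: at_most_one_box_conj (colG _ _ Dij); apply: shG => //; apply: D_le Dij.
- by apply: at_most_one_box_conj (rowG _ _ Dij); apply: shG => //; apply: D_le Dij.
Qed.

Lemma eq_sw_shape (mu mu' nu nu' la la' : nat -> nat) :
  mu =1 mu' -> nu =1 nu' -> la =1 la' -> sw_shape mu nu la =1 sw_shape mu' nu' la'.
Proof. by move=> e1 e2 e3 r; rewrite /sw_shape !e1 !e2 !e3. Qed.

Section Extend.
Variable G0 : nat -> nat -> nat -> nat.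

(** The recursion runs north-east towards the boundary of [D], hence the fuel; [K + K] suffices
    because no point of [D] has a coordinate above [K]. *)
Fixpoint extend_fuel (d i j : nat) : nat -> nat :=
  if d is d'.+1 then
    if D i.+1 j.+1 then
      sw_shape (extend_fuel d' i j.+1) (extend_fuel d' i.+1 j)
               (extend_fuel d' i.+1 j.+1)
    else G0 i j
  else G0 i j.

Definition extend := extend_fuel (K + K).

Lemma extend_fuelS d i j :
  K + K <= d + (i + j) -> extend_fuel d.+1 i j =1 extend_fuel d i j.
Proof.
elim: d i j => [|d IH] i j le_K r /=.
  by case: ifP => // /D_bound; lia.
case: ifP => // Dij; rewrite -/(extend_fuel d.+1 i j.+1).
by apply: eq_sw_shape; apply: IH; lia.
Qed.

Lemma extend_out i j : ~~ D i.+1 j.+1 -> extend i j = G0 i j.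
Proof. by rewrite /extend => /negbTE Dij; case: (K + K) => //= d; rewrite Dij. Qed.

Lemma extend_in i j : D i.+1 j.+1 ->
  extend i j =1 sw_shape (extend i j.+1) (extend i.+1 j) (extend i.+1 j.+1).
Proof.
move=> Dij r; have [iK jK] := D_bound Dij; rewrite /extend.
have [d Kd] : exists d, K + K = d.+1 by exists (K + K).-1; lia.
rewrite Kd {1}/extend_fuel Dij -/extend_fuel.
by apply: eq_sw_shape => s; rewrite extend_fuelS //; lia.
Qed.

Lemma region_ind (P : nat -> nat -> Prop) :
  (forall i j, D i j ->
    (D i.+1 j.+1 -> [/\ P i.+1 j, P i j.+1 & P i.+1 j.+1]) -> P i j) ->
  forall i j, D i j -> P i j.
Proof.
move=> step i j; have [d] := ubnP (K + K - (i + j)).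
elim: d i j => // d IH i j lt Dij; apply: step => // DS; have [] := D_bound DS.
by split; apply: IH => //; try lia; apply: D_le DS.
Qed.

Lemma extend_unique G :
  (forall i j, D i j -> ~~ D i.+1 j.+1 -> G i j =1 G0 i j) ->
  (forall i j, D i.+1 j.+1 ->
    G i j =1 sw_shape (G i j.+1) (G i.+1 j) (G i.+1 j.+1)) ->
  forall i j, D i j -> extend i j =1 G i j.
Proof.
move=> Gout Gin; apply: region_ind => i j Dij IH r.
have [DS|nDS] := boolP (D i.+1 j.+1); last by rewrite extend_out // Gout.
by have [e1 e2 e3] := IH DS; rewrite extend_in // Gin //; exact: eq_sw_shape.
Qed.

Lemma valid_extend : valid_labels G0 -> valid_labels extend.
Proof.
case=> shG G00 colG rowG.
pose P i j := [/\ shape K (extend i j), forall r, i = 0 \/ j = 0 -> extend i j r = 0,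
  D i.+1 j -> at_most_one_box K (extend i j) (extend i.+1 j)
  & D i j.+1 -> at_most_one_box K (extend i j) (extend i j.+1)].
suff H i j : D i j -> P i j.
  split=> [i j|i j r|i j|i j].
  - by case/H.
  - by case/H => _ H0 _ _; exact: H0.
  - by move=> Dij; case: (@H i j) => [|_ _ H1 _]; [exact: D_le Dij | exact: H1].
  - by move=> Dij; case: (@H i j) => [|_ _ _ H1]; [exact: D_le Dij | exact: H1].
move: i j; apply: region_ind => i j Dij IH.
have [DS|nDS] := boolP (D i.+1 j.+1); last first.
  rewrite /P extend_out //; split=> [|r|Di|Dj].
  - exact: shG.
  - exact: G00.
  (* A neighbour in [D] to the right of or above a boundary point is again a boundary point, so its
     label also comes from [G0]. *)
  - rewrite extend_out; first exact: colG.
    by apply: contra nDS; apply: D_le.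
  - rewrite extend_out; first exact: rowG.
    by apply: contra nDS; apply: D_le.
have [[sh1 z1 _ r1] [sh2 z2 c2 _] [sh3 _ _ _]] := IH DS.
have E := extend_in DS.
have eqbox f g h : f =1 g -> at_most_one_box K g h -> at_most_one_box K f h.
  move=> e [le sz]; split=> [r|]; first by rewrite e.
  by have -> : shape_size K f = shape_size K g by apply: eq_bigr => r _; exact: e.
have [b1 b2] := at_most_one_box_sw sh2 sh1 sh3 (c2 DS) (r1 DS).
split.
- have [s1 s2 s3] := shape_sw sh2 sh1 sh3 (c2 DS) (r1 DS).
  by split=> r *; rewrite ?E; auto.
- move=> r ij0; rewrite E; have := sw_shape_le (c2 DS) (r1 DS) r.
  by case: ij0 => e; [rewrite (z2 r (or_introl e)) | rewrite (z1 r (or_intror e))]; lia.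
- by move=> _; apply: eqbox b2.
- by move=> _; apply: eqbox b1.
Qed.

End Extend.
End Region.

(** * Conjugating a filling *)

(** [sA] and [sB] stand for sizes of labels, whose mixed differences are the entries. Up to the
    highest point of [D] on the right side of column [i], the column sum telescopes to a difference
    of two boundary values; above it the fillings agree. *)
Lemma eq_col_sums K (D : nat -> nat -> bool) (A B : filling) (sA sB : filling) :
  (forall i j i' j', i <= i' -> j <= j' -> D i' j' -> D i j) ->
  (forall i j, D i j -> i <= K /\ j <= K) ->
  (forall i j, D i.+1 j.+1 ->
     sA i j + sA i.+1 j.+1 = sA i.+1 j + sA i j.+1 + A i j) ->
  (forall i j, D i.+1 j.+1 ->
     sB i j + sB i.+1 j.+1 = sB i.+1 j + sB i j.+1 + B i j) ->
  (forall i, D i 0 -> sA i 0 = 0 /\ sB i 0 = 0) ->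
  (forall i j, D i j -> ~~ D i.+1 j.+1 -> sA i j = sB i j) ->
  (forall i j, ~~ D i.+1 j.+1 -> A i j = B i j) ->
  forall i n, K <= n -> \sum_(j < n) A i j = \sum_(j < n) B i j.
Proof.
move=> D_le D_bound cA cB ax bd out i n Kn.
have [D0|nD0] := boolP (D i.+1 0); last first.
  by apply: eq_bigr => j _; apply: out; apply: contra nD0; apply: D_le.
have [|j /D_bound[]//|h Dh hmax] := @ex_maxnP (D i.+1) K; first by exists 0.
have tele (C sC : filling) (cC : forall i j, D i.+1 j.+1 ->
     sC i j + sC i.+1 j.+1 = sC i.+1 j + sC i j.+1 + C i j)
     (axC : forall i, D i 0 -> sC i 0 = 0) j :
   D i.+1 j -> \sum_(b < j) C i b + sC i j = sC i.+1 j.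
  elim: j => [|j IH] Dj.
    by rewrite big_ord0 !axC // (D_le _ _ _ _ (leqnSn _) (leqnn _) Dj).
  have := cC _ _ Dj; have := IH (D_le _ _ _ _ (leqnn _) (leqnSn _) Dj).
  by rewrite big_ord_recr /=; set s := \sum_(_ < _) _; lia.
have nDh i' j : i < i' -> h < j -> ~~ D i' j.
  move=> ii' hj; apply/negP => Dij.
  by have := hmax _ (D_le _ _ _ _ ii' (leqnn _) Dij); lia.
have e1 : sA i h = sB i h.
  by apply: bd; [apply: D_le Dh | apply: nDh].
have e2 : sA i.+1 h = sB i.+1 h by apply: bd => //; apply: nDh.
have tA := tele A sA cA (fun i D => (ax i D).1) h Dh.
have tB := tele B sB cB (fun i D => (ax i D).2) h Dh.
have hn : h <= n by have [_] := D_bound _ _ Dh; lia.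
rewrite -!(big_mkord xpredT) !(@big_cat_nat _ _ _ h 0 n) //= !big_mkord.
have -> : \sum_(j < h) A i j = \sum_(j < h) B i j by lia.
congr (_ + _); rewrite !big_nat; apply: eq_bigr => j /andP[hj _].
by apply/out/nDh.
Qed.

Section ConjFilling.
Variables (K : nat) (D : nat -> nat -> bool).
Hypothesis D_le : forall i j i' j', i <= i' -> j <= j' -> D i' j' -> D i j.
Hypothesis D_bound : forall i j, D i j -> i <= K /\ j <= K.

Definition conj_labels (A : filling) :=
  extend K D (fun i j => conj_shape K (lam A i j)).

(* By [conj_filling_boundary], its shapes along the boundary of [D] are the
   conjugates of those of [A]. *)
Definition conj_filling (A : filling) : filling := fun i j =>
  if D i.+1 j.+1 then
    conj_labels A i.+1 j.+1 0 - maxn (conj_labels A i j.+1 0) (conj_labels A i.+1 j 0)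
  else A i j.

Lemma conj_labels_in A i j : D i.+1 j.+1 ->
  conj_labels A i j =1
  sw_shape (conj_labels A i j.+1) (conj_labels A i.+1 j) (conj_labels A i.+1 j.+1).
Proof. exact: extend_in. Qed.

Section Valid.
Variable A : filling.
Hypothesis ppA : partial_perm_filling A.

Lemma valid_conj_labels : valid_labels K D (conj_labels A).
Proof. exact/(valid_extend D_le D_bound)/(valid_conj D_le)/(valid_lam D_bound). Qed.

(** Induction from the axes: [lam_0] and [lam_S] compute the north-east label from the other three
    and the entry. [conj_labels] obeys the same rule, by the choice of the entry in row 0 and by
    [sw_shape_rule] in the others. *)
Lemma lam_conj_filling i j :
  D i j -> lam (conj_filling A) i j =1 conj_labels A i j.
Proof.
have [sh ax col row] := valid_conj_labels.
elim: i j => [|i IHi] j; first by move=> D0 r; rewrite ax; auto.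
elim: j => [|j IHj] Dij r; first by rewrite ax /lam ?lis0r; auto.
have Di : D i j.+1 by apply: D_le Dij.
have Dj : D i.+1 j by apply: D_le Dij.
have E1 := IHi _ Di; have E2 := IHj Dj; have E0 := IHi _ (D_le (leqnn i) (leqnSn j) Di).
case: r => [|r].
  rewrite lam_0 {}E1 {}E2 /conj_filling Dij.
  by have [/(_ 0) l1 _] := row _ _ Dij; have [/(_ 0) l2 _] := col _ _ Dij; lia.
rewrite lam_S !E1 !E2 E0 (conj_labels_in _ Dij).
exact/esym/(sw_shape_rule (sh _ _ Di) (sh _ _ Dj) (sh _ _ Dij) (col _ _ Dij) (row _ _ Dij)).
Qed.

Lemma conj_filling_boundary i j r : D i j -> ~~ D i.+1 j.+1 ->
  lam (conj_filling A) i j r = conj_shape K (lam A i j) r.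
Proof. by move=> Dij nD; rewrite lam_conj_filling // /conj_labels extend_out. Qed.

Lemma lam_sw i j : D i.+1 j.+1 ->
  lam A i j =1 sw_shape (lam A i j.+1) (lam A i.+1 j) (lam A i.+1 j.+1).
Proof.
move=> _ r; rewrite /sw_shape lam_S.
have : lam A i j r <= lam A i j.+1 r by exact: lis_leSr.
have : lam A i j r <= lam A i.+1 j r by exact: lis_leS.
by lia.
Qed.

End Valid.

Lemma eq_conj_shape_lam_conj A i j r : partial_perm_filling A ->
  D i j -> ~~ D i.+1 j.+1 ->
  conj_shape K (lam (conj_filling A) i j) r = lam A i j r.
Proof.
move=> ppA Dij nD; have [sh _ _ _] := valid_lam D_bound ppA.
rewrite (@eq_conj_shape _ _ (conj_shape K (lam A i j))); last first.
  by move=> s; exact: conj_filling_boundary.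
by apply: conj_shapeK; apply: sh.
Qed.

(** By [extend_unique] the labels of the second conjugation are the shapes of [A]: they agree on the
    boundary, as conjugating shapes is an involution, and obey the same rule inside. The entries
    follow from [lam_0]. *)
Lemma conj_fillingK A i j : partial_perm_filling A ->
  conj_filling (conj_filling A) i j = A i j.
Proof.
move=> ppA; rewrite {1}/conj_filling; case: ifP => Dij; last first.
  by rewrite /conj_filling Dij.
have E := @extend_unique K D D_le D_bound
  (fun i j => conj_shape K (lam (conj_filling A) i j)) (lam A)
  (fun a b Dab nD s => esym (eq_conj_shape_lam_conj s ppA Dab nD)) (@lam_sw A).
rewrite /conj_labels !E //; first by rewrite lam_0; lia.
  by apply: D_le Dij.
by apply: D_le Dij.
Qed.

Lemma lam_size_cell A i j : partial_perm_filling A -> D i.+1 j.+1 ->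
  shape_size K (lam A i j) + shape_size K (lam A i.+1 j.+1) =
  shape_size K (lam A i.+1 j) + shape_size K (lam A i j.+1) + A i j.
Proof.
move=> ppA Dij; have [sh ax col row] := valid_lam D_bound ppA.
have Di : D i j.+1 by apply: D_le Dij.
have Dj : D i.+1 j by apply: D_le Dij.
have := shape_size_sw (sh _ _ Di) (sh _ _ Dj) (sh _ _ Dij) (col _ _ Dij) (row _ _ Dij).
have -> : shape_size K (sw_shape (lam A i j.+1) (lam A i.+1 j) (lam A i.+1 j.+1)) =
   shape_size K (lam A i j) by apply: eq_bigr => r _; rewrite -lam_sw.
by rewrite lam_0; lia.
Qed.

Lemma conj_labels_size_cell A i j : partial_perm_filling A -> D i.+1 j.+1 ->
  shape_size K (conj_labels A i j) + shape_size K (conj_labels A i.+1 j.+1) =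
  shape_size K (conj_labels A i.+1 j) + shape_size K (conj_labels A i j.+1) +
  conj_filling A i j.
Proof.
move=> ppA Dij; have [sh ax col row] := valid_conj_labels ppA.
have Di : D i j.+1 by apply: D_le Dij.
have Dj : D i.+1 j by apply: D_le Dij.
have := shape_size_sw (sh _ _ Di) (sh _ _ Dj) (sh _ _ Dij) (col _ _ Dij) (row _ _ Dij).
have -> : shape_size K (sw_shape (conj_labels A i j.+1) (conj_labels A i.+1 j)
    (conj_labels A i.+1 j.+1)) = shape_size K (conj_labels A i j).
  by apply: eq_bigr => r _; rewrite -(conj_labels_in _ Dij).
by rewrite /conj_filling Dij; lia.
Qed.

Lemma shape_size0 f : (forall r, f r = 0) -> shape_size K f = 0.
Proof. by move=> f0; apply: big1 => r _. Qed.

Lemma conj_labels_size_boundary A i j : partial_perm_filling A ->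
  D i j -> ~~ D i.+1 j.+1 ->
  shape_size K (lam A i j) = shape_size K (conj_labels A i j).
Proof.
move=> ppA Dij nD; rewrite /conj_labels extend_out // shape_size_conj //.
by have [sh _ _ _] := valid_lam D_bound ppA; apply: sh.
Qed.

Lemma conj_filling_col_sum A i n : partial_perm_filling A -> K <= n ->
  \sum_(j < n) conj_filling A i j = \sum_(j < n) A i j.
Proof.
move=> ppA Kn; symmetry.
apply: (@eq_col_sums K D A (conj_filling A) (fun i j => shape_size K (lam A i j))
  (fun i j => shape_size K (conj_labels A i j))) => // {i n Kn}.
- by move=> i j; exact: lam_size_cell.
- by move=> i j; exact: conj_labels_size_cell.
- move=> i D0; have [_ ax _ _] := valid_conj_labels ppA.
  by split; apply: shape_size0 => r; [exact: lis0r | apply: ax; auto].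
- by move=> i j; exact: conj_labels_size_boundary.
- by move=> i j /negbTE nD; rewrite /conj_filling nD.
Qed.

Lemma conj_filling_row_sum A j n : partial_perm_filling A -> K <= n ->
  \sum_(i < n) conj_filling A i j = \sum_(i < n) A i j.
Proof.
move=> ppA Kn; symmetry.
apply: (@eq_col_sums K (fun i j => D j i) (trf A) (trf (conj_filling A))
  (fun i j => shape_size K (lam A j i))
  (fun i j => shape_size K (conj_labels A j i))) => // {j n Kn}.
- by move=> i j i' j' ii' jj'; exact: D_le.
- by move=> i j /D_bound[].
- by move=> i j Dij; rewrite lam_size_cell // /trf; lia.
- by move=> i j Dij; rewrite conj_labels_size_cell // /trf; lia.
- move=> i D0; have [_ ax _ _] := valid_conj_labels ppA.
  by split; apply: shape_size0 => r //; apply: ax; auto.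
- by move=> i j; exact: conj_labels_size_boundary.
- by move=> i j /negbTE nD; rewrite /trf /conj_filling nD.
Qed.

Lemma leq_sum_ord (F : nat -> nat) m n : m <= n -> \sum_(i < m) F i <= \sum_(i < n) F i.
Proof.
move=> mn; rewrite -!(big_mkord xpredT) [X in _ <= X](@big_cat_nat _ _ _ m) //.
exact: leq_addr.
Qed.

Lemma partial_perm_conj_filling A :
  partial_perm_filling A -> partial_perm_filling (conj_filling A).
Proof.
move=> ppA; split=> [i n|j n].
  (* Sums are only known to be preserved from length [K] on, so the sum is first lengthened. *)
  apply: leq_trans (leq_sum_ord (conj_filling A i) (leq_maxr K n)) _.
  by rewrite conj_filling_col_sum ?leq_maxl //; apply ppA.
apply: leq_trans (leq_sum_ord (fun i => conj_filling A i j) (leq_maxr K n)) _.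
by rewrite conj_filling_row_sum ?leq_maxl //; apply ppA.
Qed.

End ConjFilling.

(** * Partial occurrences of patterns *)

Definition positions (n : nat) (pos : seq nat) :=
  pairwise ltn pos && all (fun i => i < n) pos.

Lemma positionsE n pos : positions n pos = subseq pos (iota 0 n).
Proof.
apply/idP/idP => [/andP[prs pos_n]|sub].
  have -> : pos = filter [in pos] (iota 0 n).
    apply: (irr_sorted_eq ltn_trans ltnn).
    - by rewrite (sorted_pairwise ltn_trans).
    - by apply: sorted_filter; [exact: ltn_trans | exact: iota_ltn_sorted].
    - move=> i; rewrite mem_filter mem_iota /=.
      by case: (boolP (i \in pos)) => //= /(allP pos_n); rewrite add0n => ->.
  exact: filter_subseq.
apply/andP; split.
  apply: (subseq_pairwise sub); rewrite -(sorted_pairwise ltn_trans).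
  exact: iota_ltn_sorted.
by apply/allP=> i /(mem_subseq sub); rewrite mem_iota.
Qed.

(* Partial permutations are handled as functions [e : nat -> nat], with [e i]
   the [i]-th entry and 0 standing for a hole.  Only the non-holes among [pos]
   are compared with the pattern: the values of the holes are free. *)
Definition pattern_at (e : nat -> nat) (p pos : seq nat) : bool :=
  (size pos == size p) &&
  [forall a : 'I_(size p), forall b : 'I_(size p),
    (0 < e (nth 0 pos a)) && (0 < e (nth 0 pos b)) ==>
    ((e (nth 0 pos a) < e (nth 0 pos b)) == (nth 0 p a < nth 0 p b))].

Lemma pattern_atP e p pos :
  reflect (size pos = size p /\
    forall a b, a < size p -> b < size p ->
      0 < e (nth 0 pos a) -> 0 < e (nth 0 pos b) ->
      (e (nth 0 pos a) < e (nth 0 pos b)) = (nth 0 p a < nth 0 p b))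
  (pattern_at e p pos).
Proof.
apply: (iffP andP) => [[/eqP sz /forallP H]|[/eqP sz H]]; split=> //.
  move=> a b ap bp ea eb.
  by have /forallP/(_ (Ordinal bp))/implyP/= := H (Ordinal ap); rewrite ea eb => /(_ isT)/eqP.
apply/forallP => a; apply/forallP=> b; apply/implyP => /andP[ea eb].
by apply/eqP/H.
Qed.

Lemma eq_pattern_at e e' p pos :
  {in pos, e =1 e'} -> pattern_at e p pos = pattern_at e' p pos.
Proof.
move=> eqe; rewrite /pattern_at; case: eqP => //= sz.
apply: eq_forallb => a; apply: eq_forallb => b.
by rewrite !eqe // mem_nth // sz.
Qed.

Definition occurs (n : nat) (e : nat -> nat) (p : seq nat) :=
  exists2 pos, positions n pos & pattern_at e p pos.

(** Row [j] carries the value [j.+1]: a hole gives an empty column, and the point of a non-hole [i]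
    lies in the cell with north-east corner [(i.+1, e i)]. *)
Definition entry_filling (e : nat -> nat) : filling := fun i j => e i == j.+1.

Definition copy_above (e : nat -> nat) (c v : nat) (pos : seq nat) :=
  all (fun i => (c <= i) && ((0 < e i) ==> (v < e i))) pos.

Definition region (n : nat) (X : seq nat) (e : nat -> nat) (c v : nat) : bool :=
  [&& c <= n, v <= n & [exists b : n.-tuple bool,
    let pos := mask b (iota 0 n) in pattern_at e X pos && copy_above e c v pos]].

Lemma regionP n X e c v :
  reflect [/\ c <= n, v <= n & exists pos,
             [/\ positions n pos, pattern_at e X pos & copy_above e c v pos]]
    (region n X e c v).
Proof.
apply: (iffP and3P) => [[cn vn /existsP[b /= /andP[pX ab]]]|[cn vn [pos [pn pX ab]]]].
  by split=> //; exists (mask b (iota 0 n)); split=> //; rewrite positionsE mask_subseq.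
split=> //; apply/existsP; move: pn; rewrite positionsE => /subseqP[b sz epos].
have sz' : size b == n by rewrite sz size_iota.
by exists (Tuple sz') => /=; rewrite -epos pX ab.
Qed.

Section CopyRegion.
Variables (n : nat) (X : seq nat).
Implicit Type e : nat -> nat.

Lemma region_le e i j i' j' :
  i <= i' -> j <= j' -> region n X e i' j' -> region n X e i j.
Proof.
move=> ii' jj' /regionP[i'n j'n [pos [pn pX ab]]]; apply/regionP; split; try lia.
exists pos; split=> //; apply: sub_all ab => k /andP[ik /implyP kP].
by apply/andP; split; [lia | apply/implyP => /kP; lia].
Qed.

Lemma region_bound e i j : region n X e i j -> i <= n /\ j <= n.
Proof. by case/regionP. Qed.

(* A point of the copy lying in the region has a copy of [X] to its north-east,
   so a copy starting as far right as possible has no point in the region. *)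
Lemma region_copy_outside e c v : region n X e c v ->
  exists pos, [/\ positions n pos, pattern_at e X pos, copy_above e c v pos &
    all (fun i => (0 < e i) ==> ~~ region n X e i.+1 (e i)) pos].
Proof.
have [d] := ubnP (n - c); elim: d c v => // d IH c v ltd cvR.
have /regionP[cn vn [pos [pn pX ab]]] := cvR.
have [out|/allPn[i ipos]] := boolP (all (fun i => (0 < e i) ==> ~~ region n X e i.+1 (e i)) pos).
  by exists pos.
rewrite negb_imply negbK => /andP[ei iR].
have /andP[ci] := allP ab i ipos; rewrite ei => vi.
have [iSn _] := region_bound iR.
have [|pos' [pn' pX' ab' out']] := IH _ _ _ iR; first by lia.
exists pos'; split=> //; apply: sub_all ab' => k /andP[ik /implyP kP].
rewrite (leq_trans ci (ltnW ik)); apply/implyP => /kP; exact: ltn_trans.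
Qed.

Lemma entry_filling_eq e e' i :
  0 < e i -> entry_filling e i (e i).-1 = entry_filling e' i (e i).-1 -> e' i = e i.
Proof. by move=> ei; rewrite /entry_filling prednK // eqxx; case: eqP => // ->. Qed.

(** A copy of [X] with no point in the region of [e] is common to [e] and [e'], and
    [region_copy_outside] provides one for [e]. If a copy in [e'] does have a point in that region,
    then [(c, v)] is south-west of a point of the region and so belongs to it. *)
Lemma eq_region e e' :
  (forall i, (0 < e i) = (0 < e' i)) ->
  (forall i j, ~~ region n X e i.+1 j.+1 -> entry_filling e i j = entry_filling e' i j) ->
  forall c v, region n X e' c v = region n X e c v.
Proof.
move=> hole out c v; apply/idP/idP => [/regionP[cn vn [pos [pn pX ab]]]|cvR].
  have [/allP iout|/allPn[i ipos]] :=
      boolP (all (fun i => (0 < e' i) ==> ~~ region n X e i.+1 (e' i)) pos).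
    have eqe : {in pos, e' =1 e}.
      move=> i ipos; have [e0|epos] := posnP (e' i).
        by have := hole i; rewrite e0 /=; case: (e i).
      have /implyP/(_ epos) := iout i ipos.
      rewrite -{1}(prednK epos) => /out/esym/entry_filling_eq->//.
    apply/regionP; split=> //; exists pos; split=> //.
      by rewrite -(eq_pattern_at _ eqe).
    by apply/allP=> i ipos; rewrite -eqe //; exact: (allP ab).
  rewrite negb_imply negbK => /andP[ei]; apply: region_le.
    by have /andP[/leqW] := allP ab i ipos.
  by have /andP[_ /implyP/(_ ei)/ltnW] := allP ab i ipos.
have [pos [pn pX ab iout]] := region_copy_outside cvR.
have eqe : {in pos, e =1 e'}.
  move=> i ipos; have [e0|epos] := posnP (e i).
    by have := hole i; rewrite e0 /=; case: (e' i).
  have /implyP/(_ epos) := allP iout i ipos.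
  by rewrite -{1}(prednK epos) => /out/entry_filling_eq->.
have [cn vn] := region_bound cvR.
apply/regionP; split=> //; exists pos; split=> //; first by rewrite -(eq_pattern_at _ eqe).
by apply/allP=> i ipos; rewrite -eqe //; exact: (allP ab).
Qed.

Definition holes e c := count (fun i => e i == 0) (iota 0 c).

(** * Splitting an occurrence into a chain with holes and a copy of X *)

Section Split.
Variables (l : nat) (P : seq nat) (d : bool) (e : nat -> nat).
Hypothesis szP : size P = l.
Hypothesis P_le : all (fun x => x <= l) P.
Hypothesis X_gt : all (fun x => l < x) X.
Hypothesis P_lt : forall a b, a < l -> b < l ->
  (nth 0 P a < nth 0 P b) = (if d then b < a else a < b).
Hypothesis e_le : forall i, e i <= n.

Let R := if d then dec_rel else inc_rel.

Lemma occurs_chain : occurs n e (P ++ X) ->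
  exists c v k, [/\ region n X e c v, has_chain R (entry_filling e) c v k
                  & l <= holes e c + k].
Proof.
case=> pos pn /pattern_atP[]; rewrite size_cat szP => szpos ord.
have [/(pairwiseP 0) srt /allP pos_n] := andP pn.
have srt' a b : a < b -> b < l + size X -> nth 0 pos a < nth 0 pos b.
  by move=> ab bs; apply: srt; rewrite ?inE ?szpos; lia.
set pos1 := take l pos; set pos2 := drop l pos.
have sz1 : size pos1 = l by rewrite size_takel // szpos leq_addr.
have sz2 : size pos2 = size X by rewrite size_drop szpos addKn.
have n1 a : a < l -> nth 0 pos1 a = nth 0 pos a by move=> al; rewrite nth_take.
have l_ge a : (l + a < l) = false by lia.
have n2 a : nth 0 pos2 a = nth 0 pos (l + a) by rewrite nth_drop.
(* [(c, v)] is the least corner with the first [l] positions to its left and their values at most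
   [v]; holes have entry 0 and do not raise [v]. *)
pose c := \max_(i <- pos1) i.+1; pose v := \max_(i <- pos1) e i.
have c_gt i : i \in pos1 -> i < c by move=> i1; apply: leq_bigmax_seq.
have v_ge i : i \in pos1 -> e i <= v by move=> i1; apply: leq_bigmax_seq.
exists c, v, (count (fun i => 0 < e i) pos1); split.
- apply/regionP; split.
  + by apply/bigmax_leqP_seq => i /mem_take/pos_n.
  + by apply/bigmax_leqP_seq => i _ _.
  + exists pos2; split.
    * rewrite positionsE; apply: subseq_trans (drop_subseq _ _) _.
      by rewrite -positionsE.
    * apply/pattern_atP; split=> // a b aX bX; rewrite !n2 => ea eb.
      rewrite ord ?ltn_add2l //.
      by rewrite !nth_cat szP !l_ge !addKn.
    * apply/allP => i /(nthP 0)[b]; rewrite sz2 n2 => bX <-; apply/andP; split.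
        apply/bigmax_leqP_seq => i' /(nthP 0)[a]; rewrite sz1 => al <- _.
        by rewrite n1 //; apply: srt'; lia.
      apply/implyP => epos.
      suff : v <= (e (nth 0 pos (l + b))).-1 by lia.
      apply/bigmax_leqP_seq => i' /(nthP 0)[a]; rewrite sz1 => al <- _; rewrite n1 //.
      have [->|ea] := posnP (e (nth 0 pos a)); first by [].
      have : e (nth 0 pos a) < e (nth 0 pos (l + b)); last by lia.
      rewrite ord //; try lia; rewrite !nth_cat szP al l_ge addKn.
      apply: (@leq_ltn_trans l).
        by apply: (allP P_le); rewrite mem_nth ?szP.
      by apply: (allP X_gt); rewrite mem_nth.
- exists [seq (i, (e i).-1) | i <- pos1 & 0 < e i]; last by rewrite size_map size_filter.
  apply/andP; split.
    rewrite all_map all_filter; apply/allP => i i1; apply/implyP => ei /=.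
    rewrite c_gt //= /entry_filling prednK // eqxx andbT.
    by have := v_ge i i1; lia.
  rewrite pairwise_map.
  pose r i i' := (0 < e i) && (0 < e i') ==> R (i, (e i).-1) (i', (e i').-1).
  have r1 : pairwise r pos1.
    apply/(pairwiseP 0) => a b; rewrite !inE sz1 => al bl ab.
    rewrite !n1 //; apply/implyP=> /andP[ea eb].
    have := ord a b ltac:(lia) ltac:(lia) ea eb.
    have := ord b a ltac:(lia) ltac:(lia) eb ea.
    rewrite !nth_cat szP al bl !P_lt // => o1 o2.
    have := srt' a b ab ltac:(lia).
    by move: o1 o2; rewrite /R; case: (d); rewrite /dec_rel /inc_rel /=; lia.
  have : pairwise r [seq i <- pos1 | 0 < e i] by exact: pairwise_filter.
  apply: (@sub_in_pairwise _ (fun i => 0 < e i)); last exact: filter_all.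
  by move=> i i'; rewrite -[i \in _]/(0 < e i) -[i' \in _]/(0 < e i') /r => -> ->.
(* The first [l] positions are either points of the chain or holes among the first [c] columns. *)
- have := count_predC (fun i => e i == 0) pos1; rewrite sz1 => {1}<-.
  rewrite (eq_count (a2 := fun i => 0 < e i) (a1 := predC _)) => [|i]; last first.
    by rewrite /= lt0n.
  rewrite leq_add2r /holes -!size_filter; apply: uniq_leq_size.
    apply/filter_uniq/take_uniq; move: pn.
    by rewrite positionsE => /subseq_uniq; apply; exact: iota_uniq.
  by move=> i; rewrite !mem_filter mem_iota => /andP[-> /c_gt].
Qed.

Lemma pairwise_mem_or (T : eqType) (r : rel T) s x y :
  pairwise r s -> x \in s -> y \in s -> [\/ x = y, r x y | r y x].
Proof.
elim: s => //= z s IH /andP[/allP zs rs]; rewrite !inE.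
move=> /predU1P[->|xs] /predU1P[->|ys]; first by constructor 1.
- by constructor 2; apply: zs.
- by constructor 3; apply: zs.
- exact: IH.
Qed.

(** The holes before [c] fit any role, as [pattern_at] does not compare them. With the columns of
    the chain they give at least [l] positions; the first [l] of these will do, because a part of a
    chain is a chain. *)
Lemma chain_occurs c v k : region n X e c v ->
  has_chain R (entry_filling e) c v k -> l <= holes e c + k -> occurs n e (P ++ X).
Proof.
have R2 (x y : nat * nat) : R x y -> (x.2 < y.2) = ~~ d /\ (y.2 < x.2) = d.
  by rewrite /R; case: (d); rewrite /dec_rel /inc_rel; lia.
have subl a : a < l + size X -> l <= a -> a - l < size X by lia.
move=> /regionP[cn vn [pos2 [pn2 pX2 /allP ab2]]] [s /andP[/allP sA sR] szs] le_l.
have s_lt (x y : nat * nat) : x \in s -> y \in s -> x.1 < y.1 -> R x y.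
  move=> xs ys xy; case: (pairwise_mem_or sR xs ys) => // [e0|]; first by rewrite e0 ltnn in xy.
  by rewrite /R; case: (d); rewrite /dec_rel /inc_rel; lia.
pose sel := [seq i <- iota 0 c | (e i == 0) || (i \in map fst s)].
have s_e (z : nat * nat) : z \in s -> e z.1 = z.2.+1.
  by move=> /sA/and3P[_ _]; rewrite /entry_filling; case: eqP.
have le_sel : l <= size sel.
  apply: leq_trans le_l _; rewrite /holes -szs -(size_map fst s) -size_filter -size_cat.
  apply: uniq_leq_size.
    rewrite cat_uniq filter_uniq ?iota_uniq //=; apply/andP; split.
      apply/hasPn => i /mapP[z zs ->]; rewrite mem_filter s_e //.
    rewrite uniq_pairwise pairwise_map; apply: sub_pairwise sR => x y.
    by rewrite /= /R; case: (d); rewrite /dec_rel /inc_rel; lia.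
  move=> i; rewrite mem_cat !mem_filter => /orP[/andP[-> ->] //|is_].
  rewrite is_ orbT /=; case/mapP: is_ => z /sA/and3P[zc _ _] ->.
  by rewrite mem_iota.
pose pos1 := take l sel.
have sz1 : size pos1 = l by rewrite size_takel.
have pn1 : positions c pos1.
  rewrite positionsE; apply: subseq_trans (take_subseq _ _) _; exact: filter_subseq.
have [prs1 /allP pos1_c] := andP pn1; have [prs2 /allP pos2_n] := andP pn2.
have in1 i : i \in pos1 -> 0 < e i -> exists2 z, z \in s & i = z.1.
  move=> /mem_take; rewrite mem_filter => /andP[/orP[/eqP->//|/mapP[z zs ->]] _ _].
  by exists z.
have le1 i : i \in pos1 -> e i <= v.
  move=> i1; have [->//|epos] := posnP (e i).
  by have [z zs iz] := in1 i i1 epos; rewrite iz s_e //; case/and3P: (sA z zs).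
exists (pos1 ++ pos2).
  rewrite /positions pairwise_cat prs1 prs2 !andbT all_cat; apply/and3P; split.
  - apply/allrelP => i i' i1 i2; have /andP[ci' _] := ab2 i' i2.
    exact: leq_trans (pos1_c i i1) ci'.
  - by apply/allP=> i /pos1_c ic; exact: leq_trans ic cn.
  - exact/allP.
have [sz2 ord2] := pattern_atP _ _ _ pX2.
apply/pattern_atP; rewrite !size_cat sz1 sz2 szP; split=> // a b aP bP.
rewrite !nth_cat sz1 szP.
have m1 a' : a' < l -> nth 0 pos1 a' \in pos1 by move=> ?; rewrite mem_nth ?sz1.
have m2 a' : a' < l + size X -> l <= a' -> nth 0 pos2 (a' - l) \in pos2.
  by move=> *; rewrite mem_nth ?sz2 ?subl.
have P_le' a' : a' < l -> nth 0 P a' <= l.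
  by move=> ?; apply: (allP P_le); rewrite mem_nth ?szP.
have X_gt' a' : a' < l + size X -> l <= a' -> l < nth 0 X (a' - l).
  by move=> *; apply: (allP X_gt); rewrite mem_nth // subl.
have gt2 i : i \in pos2 -> 0 < e i -> v < e i.
  by move=> /ab2/andP[_ /implyP].
case: (ltnP a l) => al; case: (ltnP b l) => bl ea eb.
- rewrite P_lt //.
  have srt a' b' : a' < b' -> b' < l -> nth 0 pos1 a' < nth 0 pos1 b'.
    move=> ab' bl'; have /(pairwiseP 0) := prs1; apply; rewrite ?inE ?sz1 //.
    exact: ltn_trans ab' bl'.
  have [za zas ea'] := in1 _ (m1 a al) ea; have [zb zbs eb'] := in1 _ (m1 b bl) eb.
  have s1 := s_lt _ _ zas zbs; have s2 := s_lt _ _ zbs zas.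
  have := srt a b; have := srt b a; rewrite ea' eb' !s_e // ltnS => t1 t2.
  case: (ltngtP a b) => abl.
  + by have [-> _] := R2 _ _ (s1 (t2 abl bl)); case: (d).
  + by have [_ ->] := R2 _ _ (s2 (t1 abl al)); case: (d).
  + have -> : za = zb.
      have h1 : za.1 = zb.1 by rewrite -ea' -eb' abl.
      have h2 : za.2 = zb.2 by apply: succn_inj; rewrite -!s_e // h1.
      by rewrite (surjective_pairing za) h1 h2 -surjective_pairing.
    by rewrite ltnn; case: (d).
- rewrite (leq_ltn_trans (le1 _ (m1 a al)) (gt2 _ (m2 b bP bl) eb)).
  by rewrite (leq_ltn_trans (P_le' a al) (X_gt' b bP bl)).
- rewrite ltnNge (ltnW (leq_ltn_trans (le1 _ (m1 b bl)) (gt2 _ (m2 a aP al) ea))).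
  by rewrite ltnNge (ltnW (leq_ltn_trans (P_le' b bl) (X_gt' a aP al))).
- by apply: ord2 => //; apply: subl.
Qed.

End Split.
End CopyRegion.

Lemma eq_lam A B i j : (forall a b, A a b = B a b) -> lam A i j =1 lam B i j.
Proof.
move=> eqAB r; apply: eq_lis => a b _ _.
by elim: r a b => //= r IH a b; apply: eq_peel.
Qed.

Lemma eq_conj_filling K (D D' : nat -> nat -> bool) A B :
  D =2 D' -> A =2 B -> conj_filling K D A =2 conj_filling K D' B.
Proof.
move=> eqD eqAB i j; rewrite /conj_filling -eqD eqAB.
have E a b : conj_labels K D A a b =1 conj_labels K D' B a b.
  rewrite /conj_labels /extend; elim: (K + K) a b => [|d IH] a b /= r.
    by apply: eq_conj_shape; apply: eq_lam.
  rewrite -eqD; case: ifP => _; first exact: eq_sw_shape.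
  by apply: eq_conj_shape; apply: eq_lam.
by rewrite !E.
Qed.

Lemma has_chain_mono R A i j i' j' k : i <= i' -> j <= j' ->
  has_chain R A i j k -> has_chain R A i' j' k.
Proof.
move=> ii' jj' [s /andP[sA sR] <-]; exists s => //; rewrite /chain_in sR andbT.
by apply: sub_all sA => z /and3P[zi zj ->]; rewrite (leq_trans zi) ?(leq_trans zj).
Qed.

(** * Conjugating the entries of a partial permutation *)

Section ConjEntries.
Variables (n : nat) (X : seq nat).

Definition proper_entries (e : nat -> nat) :=
  [/\ forall i, e i <= n, forall i, n <= i -> e i = 0
    & forall i i', 0 < e i -> e i = e i' -> i = i'].

Lemma partial_perm_entries e :
  proper_entries e -> partial_perm_filling (entry_filling e).
Proof.
case=> _ _ inj; split=> [i k|j k]; rewrite /entry_filling.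
  rewrite -[\sum__ _]big_mkcond sum1_card; apply/card_le1_eqP => a b.
  by rewrite !unfold_in => /eqP ea /eqP eb; apply/val_inj/succn_inj; rewrite -ea -eb.
rewrite -[\sum__ _]big_mkcond sum1_card; apply/card_le1_eqP => a b.
rewrite !unfold_in => /eqP ea /eqP eb; by apply/val_inj/inj; rewrite /= ?ea ?eb.
Qed.

Definition conj_entry_filling e := conj_filling n (region n X e) (entry_filling e).

(** A column has at most one point, so the sum decodes its value; an empty column gives 0, that is,
    a hole. *)
Definition conj_entries (e : nat -> nat) (i : nat) : nat :=
  \sum_(j < n) conj_entry_filling e i j * j.+1.

Section Proper.
Variable e : nat -> nat.
Hypothesis eP : proper_entries e.

Let D_le i j i' j' := @region_le n X e i j i' j'.
Let D_bound i j := @region_bound n X e i j.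
Let ppA := partial_perm_entries eP.
Let ppB : partial_perm_filling (conj_entry_filling e) :=
  partial_perm_conj_filling D_le D_bound ppA.

Lemma conj_entry_filling_out i j : ~~ region n X e i.+1 j.+1 ->
  conj_entry_filling e i j = entry_filling e i j.
Proof. by move=> /negbTE nD; rewrite /conj_entry_filling /conj_filling nD. Qed.

Lemma conj_entry_filling0 i j : (n <= i) || (n <= j) -> conj_entry_filling e i j = 0.
Proof.
move=> ij; rewrite conj_entry_filling_out; last first.
  by apply/negP => /D_bound[]; lia.
have [e_le e0 _] := eP; rewrite /entry_filling; case: eqP => // eij.
by case/orP: ij => [/e0|]; [rewrite eij | have := e_le i; lia].
Qed.

Lemma conj_entriesP i j : 0 < conj_entry_filling e i j -> conj_entries e i = j.+1.
Proof.
move=> Bij; have jn : j < n.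
  by rewrite ltnNge; apply/negP => nj; rewrite conj_entry_filling0 ?nj ?orbT in Bij.
rewrite /conj_entries (bigD1 (Ordinal jn)) //= big1 => [|j' nj].
  by have := filling_le1 ppB i j; nia.
have [->//|B'] := posnP (conj_entry_filling e i j').
by case/eqP: nj; apply/val_inj/(filling_col_uniq ppB B' Bij).
Qed.

Lemma entry_filling_conj i j :
  entry_filling (conj_entries e) i j = conj_entry_filling e i j.
Proof.
rewrite /entry_filling.
have [B0|Bpos] := posnP (conj_entry_filling e i j).
  rewrite B0; case: eqP => // Eij.
  have : 0 < conj_entries e i by rewrite Eij.
  rewrite lt0n sum_nat_eq0 negb_forall => /existsP[j' /=].
  rewrite muln_eq0 orbF -lt0n => Bj'.
  by move: Eij; rewrite (conj_entriesP Bj') => -[e1]; rewrite e1 B0 in Bj'.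
by rewrite (conj_entriesP Bpos) eqxx; have := filling_le1 ppB i j; lia.
Qed.

Lemma proper_conj_entries : proper_entries (conj_entries e).
Proof.
have nz i : 0 < conj_entries e i -> exists2 j, j < n & 0 < conj_entry_filling e i j.
  rewrite lt0n sum_nat_eq0 negb_forall => /existsP[j /=].
  by rewrite muln_eq0 orbF -lt0n; exists j.
split=> [i|i ni|i i' epos eqii'].
- by have [->//|/nz[j jn /conj_entriesP->]] := posnP (conj_entries e i).
- by apply: big1 => j _; rewrite conj_entry_filling0 ?ni.
- have [j jn Bj] := nz i epos.
  have [j' j'n Bj'] := nz i' ltac:(by rewrite -eqii').
  have ejj' : j = j'.
    by apply: succn_inj; rewrite -(conj_entriesP Bj) -(conj_entriesP Bj').
  by apply: (filling_row_uniq ppB Bj); rewrite ejj'.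
Qed.

Lemma entry_gt0 f i : proper_entries f ->
  (0 < f i) = (0 < \sum_(j < n) entry_filling f i j).
Proof.
case=> f_le _ _; apply/idP/idP => [fpos|].
  have lt : (f i).-1 < n by have := f_le i; lia.
  by rewrite (bigD1 (Ordinal lt)) //= /entry_filling prednK // eqxx.
rewrite [0 < \sum__ _]lt0n sum_nat_eq0 negb_forall => /existsP[j /=].
by rewrite /entry_filling; case: (f i =P j.+1) => [->|].
Qed.

Lemma conj_entries_gt0 i : (0 < conj_entries e i) = (0 < e i).
Proof.
rewrite !entry_gt0 //; last exact: proper_conj_entries.
under eq_bigr do rewrite entry_filling_conj.
by rewrite (conj_filling_col_sum D_le D_bound).
Qed.

Lemma conj_entries_row_sum j :
  \sum_(i < n) entry_filling (conj_entries e) i j = \sum_(i < n) entry_filling e i j.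
Proof.
under eq_bigr do rewrite entry_filling_conj.
exact: (conj_filling_row_sum D_le D_bound).
Qed.

Lemma region_conj_entries : region n X (conj_entries e) =2 region n X e.
Proof.
apply: eq_region => [i|i j nD]; first by rewrite conj_entries_gt0.
by rewrite entry_filling_conj conj_entry_filling_out.
Qed.

Lemma holes_conj_entries c : holes (conj_entries e) c = holes e c.
Proof. by apply: eq_count => i; have := conj_entries_gt0 i; lia. Qed.

Lemma region_boundary c v : region n X e c v -> exists c' v',
  [/\ c <= c', v <= v', region n X e c' v' & ~~ region n X e c'.+1 v'.+1].
Proof.
have [d] := ubnP (n - c); elim: d c v => // d IH c v ltd cvR.
have [SR|nSR] := boolP (region n X e c.+1 v.+1); last by exists c, v.
have [c' [v' [cc' vv' R' nR']]] := IH c.+1 v.+1 ltac:(have [] := D_bound SR; lia) SR.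
by exists c', v'; split=> //; exact: ltnW.
Qed.

(* By [occurs_chain] and [chain_occurs], an occurrence of 1 2 ... l X
   ([R = inc_rel]) or of l ... 2 1 X ([R = dec_rel]). *)
Definition long_chain (R : rel (nat * nat)) (l : nat) (f : nat -> nat) :=
  exists c v k, [/\ region n X f c v, has_chain R (entry_filling f) c v k
                  & l <= holes f c + k].

(** Moving the corner north-east only adds points and holes, so it can be pushed to the boundary,
    where the shapes of the two fillings are conjugate. *)
Lemma long_chain_boundary R l :
  long_chain R l (conj_entries e) -> exists c v k,
  [/\ region n X e c v, ~~ region n X e c.+1 v.+1,
      has_chain R (conj_entry_filling e) c v k & l <= holes e c + k].
Proof.
move=> [c [v [k [cvR chn le_l]]]]; rewrite region_conj_entries in cvR.
have [c' [v' [cc' vv' R' nR']]] := region_boundary cvR.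
exists c', v', k; split=> //.
  apply: (has_chain_mono cc' vv'); have [s /andP[sA sR] sz] := chn.
  exists s => //; rewrite /chain_in sR andbT.
  by apply: sub_all sA => z; rewrite entry_filling_conj.
apply: leq_trans le_l _; rewrite leq_add2r holes_conj_entries /holes.
by rewrite -(subnKC cc') iotaD count_cat leq_addr.
Qed.

Let lamP i j (Dij : region n X e i j) : shape n (lam (entry_filling e) i j).
Proof. by have [sh _ _ _] := valid_lam D_bound ppA; apply: sh. Qed.

(** On the boundary, row [k] of the conjugate shape is nonempty exactly when the first row of the
    original shape is longer than [k]. *)
Lemma long_dec_chain_conj l :
  long_chain dec_rel l (conj_entries e) -> long_chain inc_rel l e.
Proof.
move=> /long_chain_boundary[c [v [[|k] [R1 nR chn le_l]]]]; exists c, v.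
  (* The empty chain is treated apart, as [has_dec_chain] concerns positive lengths. *)
  by exists 0; split=> //; exists [::].
exists k.+1; split=> //; apply/has_inc_chain => //.
have /(has_dec_chain _ _ _ ppB) := chn.
by rewrite conj_filling_boundary // lt_conj_shape //; exact: lamP.
Qed.

Lemma long_inc_chain_conj l :
  long_chain inc_rel l (conj_entries e) -> long_chain dec_rel l e.
Proof.
move=> /long_chain_boundary[c [v [[|k] [R1 nR chn le_l]]]]; exists c, v.
  by exists 0; split=> //; exists [::].
exists k.+1; split=> //; apply/has_dec_chain => //.
have /(has_inc_chain _ _ _ ppB) := chn.
rewrite -[lis _ _ _]/(lam (conj_entry_filling e) c v 0) conj_filling_boundary //.
by rewrite lt_conj_shape //; exact: lamP.
Qed.

End Proper.

Lemma conj_entriesK e : proper_entries e -> conj_entries (conj_entries e) =1 e.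
Proof.
move=> eP i; have e'P := proper_conj_entries eP.
have E j : entry_filling (conj_entries (conj_entries e)) i j = entry_filling e i j.
  rewrite (entry_filling_conj e'P) /conj_entry_filling.
  rewrite (@eq_conj_filling _ _ (region n X e) _ (conj_entry_filling e)).
  - apply: conj_fillingK; first exact: region_le.
      exact: region_bound.
    exact: partial_perm_entries.
  - exact: region_conj_entries.
  - exact: entry_filling_conj.
have [e0|epos] := posnP (e i); last exact: entry_filling_eq (esym (E _)).
have := conj_entries_gt0 e'P i; rewrite (conj_entries_gt0 eP) e0.
by case: (conj_entries _ _).
Qed.

End ConjEntries.

(** * Extensions of partial permutations *)

Lemma index_sort_lt (s : seq nat) x y : x \in s -> y \in s ->
  (index x (sort leq s) < index y (sort leq s)) = (x < y).
Proof.
have mono x' y' : x' \in s -> y' \in s ->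
    index x' (sort leq s) < index y' (sort leq s) -> x' <= y'.
  move=> xs ys; apply: (sorted_ltn_index leq_trans); rewrite ?mem_sort //.
  exact: sort_sorted leq_total _.
move=> xs ys; apply/idP/idP => [lt|lt].
  rewrite ltn_neqAle (mono _ _ xs ys lt) andbT; apply/eqP => exy.
  by rewrite exy ltnn in lt.
rewrite ltn_neqAle; apply/andP; split.
  apply/eqP => eidx; have := congr1 (nth 0 (sort leq s)) eidx.
  by rewrite !nth_index ?mem_sort // => exy; rewrite exy ltnn in lt.
rewrite leqNgt; apply/negP => /(mono _ _ ys xs); lia.
Qed.

Lemma size_standardization s : size (standardization s) = size s.
Proof. exact: size_map. Qed.

Lemma standardization_lt s a b : a < size s -> b < size s ->
  (nth 0 (standardization s) a < nth 0 (standardization s) b) =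
  (nth 0 s a < nth 0 s b).
Proof.
by move=> sa sb; rewrite !(nth_map 0) // ltnS index_sort_lt // mem_nth.
Qed.

Lemma map_index_uniq (t : seq nat) : uniq t -> [seq (index x t).+1 | x <- t] = iota 1 (size t).
Proof.
move=> ut; apply: (@eq_from_nth _ 0); rewrite size_map ?size_iota // => i it.
by rewrite (nth_map 0) // nth_iota // index_uniq.
Qed.

Lemma perm_standardization s : uniq s -> perm_eq (standardization s) (iota 1 (size s)).
Proof.
move=> us; rewrite -(size_sort leq s) -map_index_uniq ?sort_uniq //.
by apply: perm_map; rewrite perm_sym perm_sort.
Qed.

Lemma standardization_id s n : perm_eq s (iota 1 n) -> standardization s = s.
Proof.
move=> sP; have st : sort leq s = iota 1 n.
  by apply/(sorted_eq leq_trans anti_leq); rewrite ?sort_sorted ?iota_sorted ?perm_sort //;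
     exact: leq_total.
rewrite /standardization st -[RHS]map_id; apply/eq_in_map => x.
rewrite (perm_mem sP); move: x; apply/eq_in_map.
by rewrite map_index_uniq ?iota_uniq // size_iota map_id.
Qed.

(** Without repetitions, the index of an entry in the sorted sequence is the number of smaller
    entries ([idx]), which depends only on the relative order. *)
Lemma eq_standardization s t : uniq s -> uniq t -> size s = size t ->
  (forall a b, a < size s -> b < size s ->
     (nth 0 s a < nth 0 s b) = (nth 0 t a < nth 0 t b)) ->
  standardization s = standardization t.
Proof.
have idx u x : uniq u -> x \in u -> index x (sort leq u) = count (fun y => y < x) u.
  move=> uu xu; set v := sort leq u.
  have xv : x \in v by rewrite mem_sort.
  have srt : sorted ltn v by rewrite ltn_sorted_uniq_leq sort_uniq uu sort_sorted //; exact: leq_total.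
  have -> : count (fun y => y < x) u = count (fun y => y < x) v.
    by apply/permP; rewrite perm_sym perm_sort.
  have -> : count (fun y => y < x) v = count (fun i => i < index x v) (iota 0 (size v)).
    rewrite -{1}(mkseq_nth 0 v) count_map; apply: eq_in_count => i.
    rewrite mem_iota /= => iv.
    rewrite -[i in RHS](index_uniq 0 iv) ?sort_uniq // index_sort_lt //.
    by rewrite -(mem_sort leq) mem_nth.
  have lt : index x v <= size v by exact: index_size.
  rewrite -(subnKC lt) iotaD count_cat.
  rewrite (eq_in_count (a2 := predT)) => [|i]; last by rewrite mem_iota.
  rewrite count_predT size_iota (eq_in_count (a2 := pred0)) => [|i].
    by rewrite count_pred0 addn0.
  by rewrite mem_iota => /andP[le _]; apply/negbTE; rewrite -leqNgt.
move=> us ut sz ord; apply: (@eq_from_nth _ 0); rewrite !size_map // => a sa.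
rewrite !(nth_map 0) -?sz //; congr _.+1; rewrite !idx ?mem_nth -?sz //.
rewrite -{2}(mkseq_nth 0 s) -{2}(mkseq_nth 0 t) !count_map -sz.
by apply: eq_in_count => b; rewrite mem_iota /= => sb; rewrite ord.
Qed.

Lemma containsP s p :
  reflect (exists2 pos, positions (size s) pos &
             standardization [seq nth 0 s i | i <- pos] = p)
    (contains s p).
Proof.
have maskE b : mask b s = [seq nth 0 s i | i <- mask b (iota 0 (size s))].
  by rewrite map_mask -/(mkseq (nth 0 s) (size s)) mkseq_nth.
apply: (iffP existsP) => [[b /eqP bp]|[pos]].
  by exists (mask b (iota 0 (size s))); rewrite -?maskE // positionsE mask_subseq.
rewrite positionsE => /subseqP[b szb ->] <-; rewrite size_iota in szb.
by exists (@Tuple _ _ b (introT eqP szb)) => /=; rewrite maskE.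
Qed.

Lemma ltn_lex M a r a' r' : r < M -> r' < M ->
  (a * M + r < a' * M + r') = (a < a') || (a == a') && (r < r').
Proof. by move=> rM r'M; case: (ltngtP a a') => [lt|lt|->] /=; nia. Qed.

(* Fills the holes: the entries of an occurrence are ranked lexicographically,
   a hole playing the role of [nth 0 p a] being put immediately above the
   largest non-hole that has to be smaller. *)
Lemma extension_keys n (e : nat -> nat) p pos :
  (forall i, e i <= n) ->
  (forall i i', 0 < e i -> e i = e i' -> i = i') ->
  uniq p -> all (fun x => 0 < x) p ->
  positions n pos -> pattern_at e p pos ->
  exists key : nat -> nat,
  [/\ forall i i', i < n -> i' < n -> key i = key i' -> i = i',
      forall i i', 0 < e i -> 0 < e i' -> (key i < key i') = (e i < e i')
    & forall a b, a < size p -> b < size p ->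
        (key (nth 0 pos a) < key (nth 0 pos b)) = (nth 0 p a < nth 0 p b)].
Proof.
move=> e_le inj up /allP p_pos posn /pattern_atP[szpos ord].
have upos : uniq pos.
  by move: posn; rewrite positionsE => /subseq_uniq; apply; exact: iota_uniq.
pose u a := \max_(b <- iota 0 (size p) | nth 0 p b < nth 0 p a) e (nth 0 pos b).
(* [M] exceeds all second components below, which are 0, pattern entries or positions, so that the
   keys compare lexicographically. *)
pose M := (n + \max_(x <- p) x).+1.
have nM : n < M by rewrite ltnS leq_addr.
have pM x : x \in p -> x < M.
  by move=> xp; rewrite ltnS (leq_trans _ (leq_addl _ _)) // leq_bigmax_seq.
have u_le a : u a <= n by apply/bigmax_leqP_seq => b _ _.
(* Holes off the occurrence rank above all values and are told apart by their position. A hole of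
   the occurrence wins a tie against a non-hole because pattern entries are positive. *)
pose k1 i := if 0 < e i then e i else if i \in pos then u (index i pos) else n.+1.
pose k2 i := if 0 < e i then 0 else if i \in pos then nth 0 p (index i pos) else i.
have k2M i : i < n -> k2 i < M.
  move=> i_n; rewrite /k2; case: ifP => // _; case: ifP => [ip|_].
    by apply/pM/mem_nth; rewrite -szpos index_mem.
  exact: ltn_trans nM.
pose key i := k1 i * M + k2 i.
have key_gt0 i : 0 < e i -> key i = e i * M by move=> ei; rewrite /key /k1 /k2 ei addn0.
have pos_n a : a < size p -> nth 0 pos a < n.
  by move=> ap; have /andP[_ /allP] := posn; apply; rewrite mem_nth // szpos.
have key_pos a b : a < size p -> b < size p -> nth 0 p a < nth 0 p b ->
    key (nth 0 pos a) < key (nth 0 pos b).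
  move=> ap bp ab; rewrite ltn_lex ?k2M ?pos_n // /k1 /k2.
  rewrite !mem_nth ?szpos // !index_uniq ?szpos //.
  case: (posnP (e (nth 0 pos a))) => [ea|ea]; case: (posnP (e (nth 0 pos b))) => [eb|eb].
  - rewrite ab andbT orbC -leq_eqVlt; apply/bigmax_leqP_seq => c cp ca.
    by apply: (@leq_bigmax_seq _ _ _ (fun b => e (nth 0 pos b))) => //; exact: ltn_trans ab.
  - suff -> : u a < e (nth 0 pos b) by [].
    suff : u a <= (e (nth 0 pos b)).-1 by lia.
    apply/bigmax_leqP_seq => c; rewrite mem_iota /= => cp ca.
    have [->//|ec] := posnP (e (nth 0 pos c)).
    have := ord c b cp bp ec eb; rewrite (ltn_trans ca ab); lia.
  - rewrite (p_pos (nth 0 p b)) ?mem_nth // andbT orbC -leq_eqVlt.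
    by apply: (@leq_bigmax_seq _ _ _ (fun b => e (nth 0 pos b))); rewrite ?mem_iota.
  - by rewrite ord // ab.
exists key; split.
- move=> i i' i_n i'_n; rewrite /key => eqk.
  have nlt : (k1 i < k1 i') || (k1 i == k1 i') && (k2 i < k2 i') = false.
    by rewrite -(@ltn_lex M) ?k2M // eqk ltnn.
  have ngt : (k1 i' < k1 i) || (k1 i' == k1 i) && (k2 i' < k2 i) = false.
    by rewrite -(@ltn_lex M) ?k2M // eqk ltnn.
  have [e1 e2] : k1 i = k1 i' /\ k2 i = k2 i' by lia.
  have p_idx j : j \in pos -> 0 < nth 0 p (index j pos).
    by move=> jp; apply/p_pos/mem_nth; rewrite -szpos index_mem.
  move: e1 e2; rewrite /k1 /k2.
  case: (posnP (e i)) => ei; case: (posnP (e i')) => ei'.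
  + case: ifP => ip; case: ifP => i'p.
    * move=> _ /eqP; rewrite nth_uniq -?szpos ?index_mem // => /eqP eidx.
      by rewrite -(nth_index 0 ip) eidx nth_index.
    * by have := u_le (index i pos); lia.
    * by have := u_le (index i' pos); lia.
    * by [].
  + case: ifP => ip; last by have := e_le i'; lia.
    by move=> _ p0; have := p_idx i ip; rewrite p0.
  + case: ifP => ip; last by have := e_le i; lia.
    by move=> _ p0; have := p_idx i' ip; rewrite -p0.
  + by move=> + _; exact: inj.
- by move=> i i' ei ei'; rewrite !key_gt0 // ltn_mul2r.
- move=> a b ap bp; case: (ltngtP (nth 0 p a) (nth 0 p b)) => ab.
  + exact: key_pos.
  + by apply/negbTE; rewrite -leqNgt ltnW // key_pos.
  + have -> : a = b by apply/eqP; rewrite -(nth_uniq 0 ap bp up) ab.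
    exact: ltnn.
Qed.

Definition entry n (w : word n) (i : nat) : nat := oapp val 0 (nth None w i).

Section Words.
Variables (n : nat) (H : {set 'I_n}).
Implicit Types w : word n.

(** An entry [Some 0] would be mistaken for a hole by [entry]. *)
Definition positive_word w := forall v, Some v \in w -> 0 < val v.

Lemma word_nth w : [seq nth None w i | i <- iota 0 n] = w.
Proof. by rewrite -[RHS](mkseq_nth None) size_tuple. Qed.

Lemma entry_le w i : entry w i <= n.
Proof. by rewrite /entry; case: (nth _ _ _) => //= v; rewrite -ltnS. Qed.

Lemma entry_out w i : n <= i -> entry w i = 0.
Proof. by move=> ni; rewrite /entry nth_default ?size_tuple. Qed.

Lemma entry_gt0_isSome w i : positive_word w -> (0 < entry w i) = isSome (nth None w i).
Proof.
move=> wpos; rewrite /entry; case E: (nth None w i) => [v|] //=; apply: wpos.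
rewrite -E mem_nth // size_tuple ltnNge; apply/negP => ni.
by rewrite nth_default ?size_tuple in E.
Qed.

Lemma nonholes_entry w : positive_word w ->
  nonholes w = [seq entry w i | i <- iota 0 n & 0 < entry w i].
Proof.
move=> wpos; rewrite /nonholes -{1}(word_nth w).
elim: (iota 0 n) => //= i s IH.
rewrite entry_gt0_isSome //; case E: (nth None w i) => [v|] //=.
by rewrite IH /entry E.
Qed.

Lemma mask_isSome w s : positive_word w -> size s = n ->
  mask [seq isSome x | x <- w] s =
  [seq nth 0 s i | i <- iota 0 n & 0 < entry w i].
Proof.
move=> wpos sz; rewrite -{1}(mkseq_nth 0 s) sz -{1}(word_nth w) -map_comp.
rewrite filter_mask -map_mask; congr (map _ (mask _ _)).
by apply: eq_map => i /=; rewrite entry_gt0_isSome.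
Qed.

Lemma count_None_entry w : positive_word w ->
  count_mem None w = count (fun i => entry w i == 0) (iota 0 n).
Proof.
move=> wpos; rewrite -{1}(word_nth w) count_map; apply: eq_count => i /=.
by have := entry_gt0_isSome i wpos; case: (nth _ _ _) => [v|] /=; case: (entry w i).
Qed.

Lemma hole_set_entry w : positive_word w ->
  hole_set w = [set i : 'I_n | entry w i == 0].
Proof.
move=> wpos; apply/setP => i; rewrite !inE (tnth_nth None).
by have := entry_gt0_isSome i wpos; case: (nth _ _ _) => [v|] /=; case: (entry w i).
Qed.

Section PartialPerm.
Variable w : word n.
Hypothesis wP : w \in partial_perms_holes H.

Lemma perm_nonholes : perm_eq (nonholes w) (iota 1 (n - #|H|)).
Proof. by move: wP; rewrite !inE => /andP[/andP[]]. Qed.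

Lemma partial_perm_positive : positive_word w.
Proof.
move=> v vw; have : val v \in nonholes w.
  by apply: map_f; rewrite mem_pmap; apply/mapP; exists (Some v).
by rewrite (perm_mem perm_nonholes) mem_iota => /andP[].
Qed.

Lemma partial_perm_proper : proper_entries n (entry w).
Proof.
split; [exact: entry_le | exact: entry_out |].
move=> i i' ei eii'; have wpos := partial_perm_positive.
pose J := [seq i <- iota 0 n | 0 < entry w i].
have u : uniq [seq entry w i | i <- J].
  by rewrite -nonholes_entry // (perm_uniq perm_nonholes) iota_uniq.
have inJ k : 0 < entry w k -> k \in J.
  move=> ek; rewrite mem_filter ek mem_iota /= ltnNge.
  by apply/negP => /(entry_out w) e0; rewrite e0 in ek.
have iJ := inJ i ei; have i'J : i' \in J by apply: inJ; rewrite -eii'.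
rewrite -(nth_index 0 iJ) -(nth_index 0 i'J); congr nth; apply/eqP.
rewrite -(nth_uniq 0 _ _ u) ?size_map ?index_mem //.
by rewrite !(nth_map 0) ?index_mem // !nth_index // eii'.
Qed.

Lemma extensionE s : extension w s = perm_eq s (iota 1 n) &&
  (standardization [seq nth 0 s i | i <- iota 0 n & 0 < entry w i] ==
   [seq entry w i | i <- iota 0 n & 0 < entry w i]).
Proof.
rewrite /extension nonholes_entry; last exact: partial_perm_positive.
case: (boolP (perm_eq s _)) => //= /perm_size; rewrite size_iota => sz.
by rewrite mask_isSome //; exact: partial_perm_positive.
Qed.

(** An extension orders the non-holes as [w] does, so an occurrence in it satisfies [pattern_at].
    Conversely, standardizing the keys of [extension_keys] gives an extension containing [p] at the
    given positions. *)
Lemma avoidsPn p m : perm_eq p (iota 1 m) ->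
  ~~ avoids w p <-> occurs n (entry w) p.
Proof.
move=> pP; have [e_le e_out e_inj] := partial_perm_proper.
have wpos := partial_perm_positive.
have up : uniq p by rewrite (perm_uniq pP) iota_uniq.
have stdp := standardization_id pP.
set e := entry w in e_le e_out e_inj *; pose J := [seq i <- iota 0 n | 0 < e i].
have JP i : (i \in J) = (0 < e i).
  rewrite mem_filter mem_iota /=; case: (posnP (e i)) => //= ei.
  by rewrite ltnNge; apply/negP => /e_out e0; rewrite e0 in ei.
have stdJ : standardization [seq e i | i <- J] = [seq e i | i <- J].
  by apply: standardization_id; rewrite -nonholes_entry //; exact: perm_nonholes.
have uJ : uniq J by apply/filter_uniq/iota_uniq.
rewrite /avoids; split=> [/allPn[s _]|[pos posn pat]].
  rewrite negb_imply negbK extensionE => /andP[/andP[sP /eqP stds] /containsP[pos posn stdpos]].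
  have szs : size s = n by rewrite (perm_size sP) size_iota.
  rewrite szs in posn; exists pos => //; apply/pattern_atP.
  have szp : size pos = size p by rewrite -stdpos size_standardization size_map.
  split=> // a b ap bp ea eb.
  have <- : nth 0 s (nth 0 pos a) < nth 0 s (nth 0 pos b) = (nth 0 p a < nth 0 p b).
    by rewrite -stdpos standardization_lt ?size_map ?szp // !(nth_map 0) ?szp.
  have Ja : nth 0 pos a \in J by rewrite JP.
  have Jb : nth 0 pos b \in J by rewrite JP.
  rewrite -{1}(nth_index 0 Ja) -{1}(nth_index 0 Jb).
  rewrite -!(nth_map 0 0 e) ?index_mem // -stds standardization_lt ?size_map ?index_mem //.
  by rewrite !(nth_map 0) ?index_mem // !nth_index.
have p_pos : all (fun x => 0 < x) p.
  by rewrite (perm_all _ pP); apply/allP => x; rewrite mem_iota => /andP[].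
have [key [kinj kJ kpos]] := extension_keys e_le e_inj up p_pos posn pat.
pose t := [seq key i | i <- iota 0 n]; pose s := standardization t.
have ut : uniq t.
  rewrite map_inj_in_uniq ?iota_uniq // => i i'; rewrite !mem_iota => /= *.
  exact: kinj.
have szt : size t = n by rewrite size_map size_iota.
have sP : perm_eq s (iota 1 n) by rewrite -[in iota 1 n]szt; exact: perm_standardization.
have szs : size s = n by rewrite size_standardization.
have us : uniq s by rewrite (perm_uniq sP) iota_uniq.
have s_lt i i' : i < n -> i' < n -> (nth 0 s i < nth 0 s i') = (key i < key i').
  move=> i_n i'_n; rewrite standardization_lt ?szt //.
  by rewrite !(nth_map 0) ?size_iota // !nth_iota.
clearbody s.
have us_map r : uniq r -> all (fun i => i < n) r -> uniq [seq nth 0 s i | i <- r].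
  move=> ur /allP r_n; rewrite map_inj_in_uniq // => i i' /r_n i_n /r_n i'_n /eqP.
  by rewrite nth_uniq ?szs // => /eqP.
have [_ /allP pos_n] := andP posn.
have upos : uniq pos.
  by move: posn; rewrite positionsE => /subseq_uniq; apply; exact: iota_uniq.
have [szp _] := pattern_atP _ _ _ pat.
have J_n : all (fun i => i < n) J.
  by apply/allP => i; rewrite mem_filter mem_iota => /andP[_ /andP[]].
apply/allPn; exists s; first by rewrite mem_permutations.
rewrite negb_imply negbK extensionE sP /=; apply/andP; split.
  apply/eqP; rewrite -/J -[RHS]stdJ; apply: eq_standardization.
  - exact: us_map.
  - by rewrite -nonholes_entry // (perm_uniq perm_nonholes) iota_uniq.
  - by rewrite !size_map.
  - rewrite size_map => a b aJ bJ; rewrite !(nth_map 0) //.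
    by rewrite s_lt ?(allP J_n) ?mem_nth // kJ // -JP mem_nth.
apply/containsP; exists pos; rewrite ?szs //.
rewrite -[RHS]stdp; apply: eq_standardization => //.
- by apply: us_map => //; apply/allP.
- by rewrite size_map.
- rewrite size_map => a b apos bpos; rewrite !(nth_map 0) //.
  by rewrite s_lt ?pos_n ?mem_nth // kpos // -szp.
Qed.

End PartialPerm.

(** * The involution on partial permutations with a given set of holes *)

Section Conj.
Variable X : seq nat.

Definition conj_word w : word n :=
  [tuple let v := conj_entries n X (entry w) i in
         if v == 0 then None else Some (inord v) | i < n].

Lemma entry_conj_word w : w \in partial_perms_holes H ->
  entry (conj_word w) =1 conj_entries n X (entry w).
Proof.
move=> wP i; have [v_le v_out _] := proper_conj_entries X (partial_perm_proper wP).
have [i_n|n_i] := ltnP i n; last by rewrite entry_out ?v_out.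
rewrite /entry -[i in LHS]/(val (Ordinal i_n)) -tnth_nth tnth_mktuple /=.
by case: eqP => [->//|_] /=; rewrite inordK // ltnS.
Qed.

Lemma count_nonholes w v : positive_word w ->
  count_mem v.+1 (nonholes w) = \sum_(i < n) entry_filling (entry w) i v.
Proof.
move=> wpos; rewrite nonholes_entry // count_map count_filter.
rewrite -sum1_count -[in iota 0 n](subn0 n) big_mkcond big_mkord.
apply: eq_bigr => i _.
by rewrite /entry_filling /=; case: eqP => //= ->.
Qed.

Lemma conj_word_partial_perm w :
  w \in partial_perms_holes H -> conj_word w \in partial_perms_holes H.
Proof.
move=> wP; have wpos := partial_perm_positive wP.
have eP := partial_perm_proper wP; have E := entry_conj_word wP.
have pos' : positive_word (conj_word w).
  move=> v /mapP[i _] /=; case: ifP => // /negbT; rewrite -lt0n => lt [->].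
  rewrite /= inordK // ltnS.
  by have [v_le _ _] := proper_conj_entries X eP.
have hole0 i : (entry (conj_word w) i == 0) = (entry w i == 0).
  by rewrite E; have := conj_entries_gt0 X eP i; do 2!case: (_ i).
have eH : hole_set (conj_word w) = hole_set w.
  by rewrite !hole_set_entry //; apply/setP => i; rewrite !inE hole0.
have ec : count_mem None (conj_word w) = count_mem None w.
  by rewrite !count_None_entry //; apply: eq_count.
have ep : perm_eq (nonholes (conj_word w)) (nonholes w).
  (* Multiplicities are compared value by value: that of [v.+1] is the sum of row [v], which
     conjugation preserves. *)
  apply/allP => x _; apply/eqP; case: x => [|v].
    have no0 u : positive_word u -> count_mem 0 (nonholes u) = 0.
      move=> upos; apply/count_memPn; rewrite nonholes_entry //.
      by apply/mapP => -[i]; rewrite mem_filter => /andP[+ _] e0; rewrite -e0.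
    by rewrite !no0.
  rewrite !count_nonholes // -(conj_entries_row_sum X eP).
  by apply: eq_bigr => i _; rewrite /entry_filling E.
by move: wP; rewrite !inE eH ec (permPl ep).
Qed.

Lemma word_eq_entry w1 w2 : positive_word w1 -> positive_word w2 ->
  entry w1 =1 entry w2 -> w1 = w2.
Proof.
move=> p1 p2 e12; apply/val_inj; rewrite /= -(word_nth w1) -(word_nth w2).
apply: eq_map => i; have := e12 i; rewrite /entry.
have := entry_gt0_isSome i p1; have := entry_gt0_isSome i p2; rewrite /entry.
case: (nth _ w1 i) => [v1|]; case: (nth _ w2 i) => [v2|] //= h2 h1 h.
- by congr Some; apply/val_inj.
- by rewrite h in h1.
- by rewrite -h in h2.
Qed.

Lemma eq_conj_entries e e' : e =1 e' -> conj_entries n X e =1 conj_entries n X e'.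
Proof.
move=> ee i; apply: eq_bigr => j _; congr (_ * _).
apply: eq_conj_filling => [c v|a b]; last by rewrite /entry_filling ee.
by apply: eq_region => [a|a b _]; rewrite /entry_filling ee.
Qed.

Lemma conj_wordK : {in partial_perms_holes H, cancel conj_word conj_word}.
Proof.
move=> w wP; have w'P := conj_word_partial_perm wP.
apply: word_eq_entry => [||i].
- exact/partial_perm_positive/conj_word_partial_perm.
- exact: partial_perm_positive wP.
- rewrite entry_conj_word // (eq_conj_entries (entry_conj_word wP)).
  exact/conj_entriesK/partial_perm_proper.
Qed.

Lemma leq_avoid_count p q :
  (forall w, w \in partial_perms_holes H -> avoids w p -> avoids (conj_word w) q) ->
  avoid_count H p <= avoid_count H q.
Proof.
move=> pq; rewrite /avoid_count -(card_in_imset (f := conj_word)).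
  apply/subset_leq_card/subsetP => w' /imsetP[w]; rewrite inE => /andP[wP wp] ->.
  by rewrite inE conj_word_partial_perm ?pq.
move=> w1 w2 /setIdP[w1P _] /setIdP[w2P _] e12.
by rewrite -(conj_wordK w1P) e12 conj_wordK.
Qed.

End Conj.
End Words.

Theorem theorem6 (l m : nat) (X : seq nat)
    (hl : 0 < l) (hlm : l <= m)
    (hX : perm_eq X (iota l.+1 (m - l))) :
  strongly_star_Wilf_equivalent (iota 1 l ++ X) (rev (iota 1 l) ++ X).
Proof.
move=> n H.
have XP : all (fun x => l < x) X.
  by rewrite (perm_all _ hX); apply/allP => x; rewrite mem_iota => /andP[].
have incP : all (fun x => x <= l) (iota 1 l).
  by apply/allP => x; rewrite mem_iota; lia.
have decP : all (fun x => x <= l) (rev (iota 1 l)) by rewrite all_rev.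
have inc_lt a b : a < l -> b < l ->
    (nth 0 (iota 1 l) a < nth 0 (iota 1 l) b) = (if false then b < a else a < b).
  by move=> al bl; rewrite !nth_iota // ltn_add2l.
have dec_lt a b : a < l -> b < l -> (nth 0 (rev (iota 1 l)) a <
    nth 0 (rev (iota 1 l)) b) = (if true then b < a else a < b).
  by move=> al bl; rewrite !nth_rev ?size_iota // !nth_iota; lia.
have sz_rev : size (rev (iota 1 l)) = l by rewrite size_rev size_iota.
have perm_inc : perm_eq (iota 1 l ++ X) (iota 1 m).
  by rewrite -(subnKC hlm) iotaD perm_cat2l add1n.
have perm_dec : perm_eq (rev (iota 1 l) ++ X) (iota 1 m).
  by apply: perm_trans perm_inc; rewrite perm_cat2r perm_rev.
(* [entry_conj_word] is only a pointwise equality, so each part of [long_chain] is transported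
   separately. *)
have chain w (wP : w \in partial_perms_holes H) : forall R,
    long_chain n X R l (entry (conj_word X w)) ->
    long_chain n X R l (conj_entries n X (entry w)).
  have E := entry_conj_word X wP.
  move=> R [c [v [k [cvR [s /andP[sA sR] szs] le_l]]]]; exists c, v, k; split.
  - move: cvR; rewrite (@eq_region n X (conj_entries n X (entry w))) // => a *.
      by rewrite E.
    by rewrite /entry_filling E.
  - exists s => //; rewrite /chain_in sR andbT; apply: sub_all sA => z.
    by rewrite /entry_filling E.
  - move: le_l; rewrite /holes.
    by rewrite (eq_count (a2 := fun i => conj_entries n X (entry w) i == 0)) // => i; rewrite E.
(* The same involution gives both inequalities: an occurrence in the conjugated word becomes a long
   chain there, then a chain of the other kind in [w], and so an occurrence of the other pattern in
   [w]. *)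
apply/eqP; rewrite eqn_leq; apply/andP; split;
  apply: (@leq_avoid_count _ _ X) => w wP; apply: contraLR;
  have w'P := conj_word_partial_perm X wP; have eP := partial_perm_proper wP.
- move=> /(avoidsPn w'P perm_dec).
  move=> /(occurs_chain (d := true) sz_rev decP XP dec_lt (entry_le _)).
  move=> /(chain w wP)/(long_dec_chain_conj eP)[c [v [k [cvR chn le_l]]]].
  apply/(avoidsPn wP perm_inc).
  exact: (chain_occurs (d := false) (size_iota 1 l) incP XP inc_lt cvR chn).
- move=> /(avoidsPn w'P perm_inc).
  move=> /(occurs_chain (d := false) (size_iota 1 l) incP XP inc_lt (entry_le _)).
  move=> /(chain w wP)/(long_inc_chain_conj eP)[c [v [k [cvR chn le_l]]]].
  apply/(avoidsPn wP perm_dec).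
  exact: (chain_occurs (d := true) sz_rev decP XP dec_lt cvR chn).
Qed.
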